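(* Let $n\geq 3$ and $2\leq s<\infty$ be integers and let $\{4,3^{n-2}\}$ denote the $n$-cube. Then $2^{\{4,3^{n-2}\},\mathcal{G}(s)}$ is a regular $(n+1)$-polytope of type $\{4,4,3^{n-2}\}$ with automorphism group $D_s^{2^{n-1}}\rtimes[4,3^{n-2}]$ of order $(2s)^{2^{n-1}}2^n n!$. In terms of its distinguished generators $\rho_0,\dots,\rho_n$, a complete set of defining relations of this group consists of those of the Coxeter group $[4,4,3^{n-2}]$, namely $$\rho_i^2=id\ (0\leq i\leq n),\quad (\rho_0\rho_1)^4=(\rho_1\rho_2)^4=id,\quad (\rho_i\rho_{i+1})^3=id\ (2\leq i\leq n-1),\quad (\rho_i\rho_j)^2=id\ (|i-j|\geq 2),$$ together with the extra relations $$(\rho_0\beta^{-i}\rho_0\beta^i)^2=id\ \text{ for } 2\leq i\leq n-1,\qquad (\rho_0\beta^n\rho_0\beta^n)^s=id,$$ where $\beta=\rho_1\rho_2\cdots\rho_n$. Moreover, its toroidal residue is the map $\{4,4\}_{(4,0)}$.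
   Context: C-groups and polytopes: a C-group of rank $m$ is a group $G$ with generating involutions $\rho_0,\dots,\rho_{m-1}$ satisfying $\langle\rho_i\mid i\in I\rangle\cap\langle\rho_j\mid j\in J\rangle=\langle\rho_k\mid k\in I\cap J\rangle$ for all $I,J\subseteq\{0,\dots,m-1\}$; it is a string C-group if $(\rho_i\rho_j)^2=id$ whenever $|i-j|\geq 2$. Abstract regular polytopes $\mathcal{P}$ of rank $m$ are in one-to-one correspondence with string C-groups $G(\mathcal{P})$ of rank $m$: the $i$-faces are the right cosets of $\langle\rho_j\mid j\neq i\rangle$, and vertices are the $0$-faces. The Schläfli type is $\{p_1,\dots,p_{m-1}\}$, $p_i$ being the order of $\rho_{i-1}\rho_i$, and $[p_1,\dots,p_{m-1}]$ denotes the corresponding Coxeter group with linear diagram. An exponent as in $3^{n-2}$ means a row of $n-2$ threes. Construction of $2^{\mathcal{P},\mathcal{G}(s)}$: let $\mathcal{P}$ be a centrally symmetric regular $n$-polytope with group $G(\mathcal{P})=\langle\tau_0,\dots,\tau_{n-1}\rangle$, i.e. $G(\mathcal{P})$ has a proper central involution $\alpha$ fixing no vertex. Let $F_0$ be the base vertex, stabilized by $\langle\tau_1,\dots,\tau_{n-1}\rangle$. Let $W$ be the Coxeter group generated by involutions $\sigma_F$, one for each vertex $F$ of $\mathcal{P}$, with defining relations $\sigma_F^2=id$, $(\sigma_F\sigma_{F\alpha})^s=id$, and $(\sigma_F\sigma_{F'})^2=id$ for $F'\notin\{F,F\alpha\}$; so $W\cong D_s^{q}$, where $q$ is half the number of vertices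 and $D_s$ is the dihedral group of order $2s$. The group $G(\mathcal{P})$ acts on $W$ by $\tau^{-1}\sigma_F\tau=\sigma_{F\tau}$. Then $2^{\mathcal{P},\mathcal{G}(s)}$ is the regular $(n+1)$-polytope with group $G(2^{\mathcal{P},\mathcal{G}(s)}):=W\rtimes G(\mathcal{P})=\langle\rho_0,\dots,\rho_n\rangle$, where $\rho_0:=\sigma_{F_0}$ and $\rho_i:=\tau_{i-1}$ for $1\leq i\leq n$. For the $n$-cube, $G(\mathcal{P})=[4,3^{n-2}]$ and $\alpha=(\tau_0\tau_1\cdots\tau_{n-1})^n$. The toroidal residue is the rank $3$ regular polytope (a map) with group $\langle\rho_0,\rho_1,\rho_2\rangle$. The map $\{4,4\}_{(4,0)}$ is the regular toroidal map whose group is the quotient of $[4,4]=\langle\rho_0,\rho_1,\rho_2\rangle$ by the relation $(\rho_0\rho_1\rho_2\rho_1)^4=id$. *)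

(* Defs.v *)
From HB Require Import structures.
From mathcomp Require Import all_boot all_fingroup all_solvable.
From mathcomp Require Import generic_quotient.
From mathcomp Require Import boolp classical_sets functions cardinality.

Set Implicit Arguments.
Unset Strict Implicit.
Unset Printing Implicit Defensive.

Local Open Scope quotient_scope.
Local Open Scope classical_set_scope.
Local Open Scope group_scope.

Section Words.
Variable I : Type.

(* The letter (i, false) stands for the generator x_i, (i, true) for its
   formal inverse. *)
Definition word := seq (I * bool).

Definition wgen (i : I) : word := [:: (i, false)].
Definition winv (w : word) : word := [seq (x.1, ~~ x.2) | x <- rev w].
Definition wpow (w : word) (k : nat) : word := flatten (nseq k w).

Inductive pres_eq (R : set word) : word -> word -> Prop :=
| pres_refl w : pres_eq R w w
| pres_sym v w : pres_eq R v w -> pres_eq R w v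
| pres_trans u v w : pres_eq R u v -> pres_eq R v w -> pres_eq R u w
| pres_cancel u v i b : pres_eq R (u ++ [:: (i, b); (i, ~~ b)] ++ v) (u ++ v)
| pres_rel u v r : R r -> pres_eq R (u ++ r ++ v) (u ++ v).

Lemma pres_ctx R a b u v :
  pres_eq R u v -> pres_eq R (a ++ u ++ b) (a ++ v ++ b).
Proof.
elim=> {u v} [w|v w _|u v w _ + _|u v i c|u v r Rr].
- exact: pres_refl.
- exact: pres_sym.
- exact: pres_trans.
- rewrite -!catA !(catA a u); exact: pres_cancel.
- rewrite -!catA !(catA a u); exact: pres_rel.
Qed.

Lemma pres_cat R u u' v v' :
  pres_eq R u u' -> pres_eq R v v' -> pres_eq R (u ++ v) (u' ++ v').
Proof.
move=> /(pres_ctx [::] v) /= uu' /(pres_ctx u' [::]); rewrite !cats0.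
exact: pres_trans.
Qed.

Lemma winv_cat u v : winv (u ++ v) = winv v ++ winv u.
Proof. by rewrite /winv rev_cat map_cat. Qed.

Lemma pres_winvr R w : pres_eq R (w ++ winv w) [::].
Proof.
elim: w => [|[i b] w IHw]; first exact: pres_refl.
rewrite -cat1s winv_cat -catA (catA w).
apply: pres_trans (pres_ctx _ _ IHw) _ => /=.
exact: (pres_cancel R [::] [::]).
Qed.

Lemma winvK w : winv (winv w) = w.
Proof.
rewrite /winv -map_rev revK -map_comp -[RHS]map_id.
by apply: eq_map => -[i b] /=; rewrite negbK.
Qed.

Lemma pres_winvl R w : pres_eq R (winv w ++ w) [::].
Proof. by rewrite -{2}(winvK w); exact: pres_winvr. Qed.

Lemma pres_winv R u v : pres_eq R u v -> pres_eq R (winv u) (winv v).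
Proof.
move=> uv; apply: (@pres_trans _ _ (winv u ++ v ++ winv v)).
  apply: pres_sym; rewrite -[X in pres_eq _ _ X]cats0.
  exact: pres_cat (pres_refl _ _) (pres_winvr _ _).
rewrite catA; apply: (@pres_trans _ _ (winv u ++ u ++ winv v)).
  rewrite -catA; apply: pres_ctx; exact: pres_sym.
by rewrite catA; apply: (pres_cat (pres_winvl _ _) (pres_refl _ _)).
Qed.

End Words.

Definition wmap (I J : Type) (f : I -> J) (w : word I) : word J :=
  [seq (f x.1, x.2) | x <- w].

Lemma pres_wmap (I J : Type) (f : I -> J) (R : set (word I)) (S : set (word J)) :
  (forall r, R r -> S (wmap f r)) ->
  forall u v, pres_eq R u v -> pres_eq S (wmap f u) (wmap f v).
Proof.
move=> RS u v; elim=> {u v} [w|v w _|u v w _ + _|u v i b|u v r Rr].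
- exact: pres_refl.
- exact: pres_sym.
- exact: pres_trans.
- rewrite /wmap !map_cat; exact: pres_cancel.
- rewrite /wmap !map_cat; exact/pres_rel/RS.
Qed.

Section PresentedGroup.
Variables (I : choiceType) (R : set (word I)).

Definition pres_eqb (u v : word I) : bool := `[< pres_eq R u v >].

Lemma pres_eqb_equiv : equiv_class_of pres_eqb.
Proof.
split=> [w|u v|v u w]; first exact/asboolP/pres_refl.
  by apply/asboolP/asboolP; exact: pres_sym.
by move=> /asboolP uv /asboolP vw; apply/asboolP/(pres_trans uv).
Qed.

Canonical pres_equiv := EquivRelPack pres_eqb_equiv.

(* The group < x_i (i in I) | r = 1 (r in R) >. *)
Definition pres := {eq_quot pres_equiv}.
HB.instance Definition _ := Choice.on pres.
HB.instance Definition _ := EqQuotient.on pres.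

Definition pcls (w : word I) : pres := \pi_pres w.
Definition pgen (i : I) : pres := pcls (wgen i).

Lemma pcls_eq u v : pcls u = pcls v <-> pres_eq R u v.
Proof.
rewrite /pcls; split=> [/eqP|uv]; first by rewrite eqmodE => /asboolP.
by apply/eqP; rewrite eqmodE; apply/asboolP.
Qed.

Lemma pcls_repr x : pcls (repr x) = x. Proof. exact: reprK. Qed.

Lemma repr_pcls w : pres_eq R (repr (pcls w)) w.
Proof. exact/pcls_eq/pcls_repr. Qed.

Definition pone : pres := pcls [::].
Definition pmul (x y : pres) : pres := pcls (repr x ++ repr y).
Definition pinv (x : pres) : pres := pcls (winv (repr x)).

Lemma pclsM u v : pcls (u ++ v) = pmul (pcls u) (pcls v).
Proof. by apply/pcls_eq/pres_sym/pres_cat; exact: repr_pcls. Qed.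

Lemma pclsV u : pcls (winv u) = pinv (pcls u).
Proof. by apply/pcls_eq/pres_sym/pres_winv/repr_pcls. Qed.

Lemma pmulA : associative pmul.
Proof.
move=> x y z; rewrite -(pcls_repr x) -(pcls_repr y) -(pcls_repr z).
by rewrite -!pclsM catA.
Qed.
Lemma pmul1 : left_id pone pmul.
Proof. by move=> x; rewrite -(pcls_repr x) -pclsM. Qed.
Lemma pmulr1 : right_id pone pmul.
Proof. by move=> x; rewrite -(pcls_repr x) -pclsM cats0. Qed.
Lemma pmulV : left_inverse pone pinv pmul.
Proof.
move=> x; rewrite -(pcls_repr x) -pclsV -pclsM; exact/pcls_eq/pres_winvl.
Qed.
Lemma pmulrV : right_inverse pone pinv pmul.
Proof.
move=> x; rewrite -(pcls_repr x) -pclsV -pclsM; exact/pcls_eq/pres_winvr.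
Qed.

HB.instance Definition _ :=
  isGroup.Build pres pmulA pmul1 pmulr1 pmulV pmulrV.

End PresentedGroup.

(* The relators R, in letters standing for the g i, are a complete set of
   defining relations for the subgroup generated by the g i. *)
Definition presented_by (I : choiceType) (G : groupType) (g : I -> G)
    (R : set (word I)) : Prop :=
  exists f : {multiplicative pres R -> G},
    injective f /\ forall i, f (pgen R i) = g i.

(* As usual, M i j = 0 stands for the absence of a relation. *)
Definition coxeter_relators (I : Type) (M : I -> I -> nat) : set (word I) :=
  [set wpow (wgen ij.1 ++ wgen ij.2) (M ij.1 ij.2) | ij in [set: I * I]].

(* Coxeter matrix of the string Coxeter group [p_1, ..., p_{m-1}]. *)
Definition string_matrix (m : nat) (p : seq nat) (i j : 'I_m) : nat :=
  (if i == j then 1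
   else if j == i.+1 :> nat then nth 0 p i
   else if i == j.+1 :> nat then nth 0 p j
   else 2)%N.

Arguments string_matrix : clear implicits.

Section Generation.
Variable G : groupType.

Definition is_subgroup (H : set G) : Prop :=
  H 1 /\ forall x y, H x -> H y -> H (x * y^-1).

Definition generated (A : set G) : set G := smallest is_subgroup A.

(* k = 0 means infinite order. *)
Definition has_order (x : G) (k : nat) : Prop :=
  forall j : nat, x ^+ j = 1 <-> (k %| j)%N.

Record string_C_group (m : nat) (rho : 'I_m -> G) : Prop := StringCGroup {
  scg_generates : generated (range rho) = [set: G];
  scg_involution : forall i, rho i != 1 /\ rho i ^+ 2 = 1;
  scg_intersection : forall I J : set 'I_m,
    generated (rho @` I) `&` generated (rho @` J) = generated (rho @` (I `&` J));
  scg_string : forall i j : 'I_m, (i.+1 < j)%N || (j.+1 < i)%N ->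
    (rho i * rho j) ^+ 2 = 1
}.

Definition schlafli_type (m : nat) (rho : 'I_m -> G) (p : seq nat) : Prop :=
  size p = m.-1 /\
  forall i j : 'I_m, j = i.+1 :> nat -> has_order (rho i * rho j) (nth 0%N p i).

End Generation.

Section Vertices.
Variables (G : groupType) (n : nat) (tau : 'I_n -> G).

Definition vertex_stab : set G := generated (tau @` [set i : 'I_n | (0 < i)%N]).

Definition rcos (x : G) : set G := [set h * x | h in vertex_stab].

Definition vertex : Type := {A : set G | exists x, A = rcos x}.
HB.instance Definition _ := gen_eqMixin vertex.
HB.instance Definition _ := gen_choiceMixin vertex.

Lemma vertex_inj (F F' : vertex) : sval F = sval F' -> F = F'.
Proof.
case: F F' => [A hA] [B hB] /= AB; rewrite -{}AB in hB *.
by congr exist; exact: Prop_irrelevance.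
Qed.

Definition base_vertex : vertex := exist _ (rcos 1) (ex_intro _ 1 erefl).

Lemma vtrans_subproof (F : vertex) (g : G) :
  exists x, [set y * g | y in sval F] = rcos x.
Proof.
case: F => _ /= [x ->]; exists (x * g); rewrite image_comp.
by apply: eq_imagel => h _ /=; rewrite mulgA.
Qed.

Definition vtrans (g : G) (F : vertex) : vertex :=
  exist _ _ (vtrans_subproof F g).

Lemma vtrans1 F : vtrans 1 F = F.
Proof.
apply: vertex_inj => /=; rewrite -[RHS]image_id.
by apply: eq_imagel => h _ /=; rewrite mulg1.
Qed.

Lemma vtransM g h F : vtrans h (vtrans g F) = vtrans (g * h) F.
Proof.
apply: vertex_inj => /=; rewrite image_comp.
by apply: eq_imagel => x _ /=; rewrite mulgA.
Qed.

Record centrally_symmetric_polytope (alpha : G) : Prop := CentrallySymmetric {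
  csp_regular : string_C_group tau;
  csp_neq1 : alpha != 1;
  csp_invol : alpha ^+ 2 = 1;
  csp_central : forall g, commute alpha g;
  csp_vertex : forall F, vtrans alpha F <> F
}.

End Vertices.

(* Right actions of G on W by automorphisms. *)
Record autaction (G W : groupType) := AutAction {
  aact :> G -> W -> W;
  aact1 : forall w, aact 1 w = w;
  aactM : forall g h w, aact (g * h) w = aact h (aact g w);
  aactJ : forall g w w', aact g (w * w') = aact g w * aact g w'
}.

(* The semidirect product of the normal subgroup W by G, in which g^-1 w g is
   a g w; the pair (g, w) stands for the product g w. *)
Definition sdprod_of (G W : groupType) (a : autaction G W) : Type := (G * W)%type.

Section SemidirectProduct.
Variables (G W : groupType) (a : autaction G W).

HB.instance Definition _ := Choice.copy (sdprod_of a) (G * W)%type.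

Definition sdone : sdprod_of a := (1, 1).
Definition sdmul (x y : sdprod_of a) : sdprod_of a :=
  (x.1 * y.1, a y.1 x.2 * y.2).
Definition sdinv (x : sdprod_of a) : sdprod_of a := (x.1^-1, (a x.1^-1 x.2)^-1).

Lemma aact_1 g : a g 1 = 1.
Proof. by apply: (mulgI (a g 1)); rewrite -aactJ !mulg1. Qed.

Lemma aact_V g w : a g w^-1 = (a g w)^-1.
Proof. by apply: (mulgI (a g w)); rewrite -aactJ !mulgV aact_1. Qed.

Lemma sdmulA : associative sdmul.
Proof. by move=> x y z; rewrite /sdmul /= !mulgA aactJ -aactM. Qed.
Lemma sdmul1 : left_id sdone sdmul.
Proof. by case=> g w; rewrite /sdmul /= aact_1 !mul1g. Qed.
Lemma sdmulr1 : right_id sdone sdmul.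
Proof. by case=> g w; rewrite /sdmul /= aact1 !mulg1. Qed.
Lemma sdmulV : left_inverse sdone sdinv sdmul.
Proof.
by case=> g w; rewrite /sdmul /= aact_V -aactM !mulVg aact1 mulVg.
Qed.
Lemma sdmulrV : right_inverse sdone sdinv sdmul.
Proof. by case=> g w; rewrite /sdmul /= !mulgV. Qed.

HB.instance Definition _ :=
  isGroup.Build (sdprod_of a) sdmulA sdmul1 sdmulr1 sdmulV sdmulrV.

End SemidirectProduct.

(* The group of 2^{P,G(s)}, where P is the regular polytope with distinguished
   generators tau_0, ..., tau_{n-1} and central symmetry alpha. *)
Section Twisting.
Variables (G : groupType) (n : nat) (tau : 'I_n -> G) (alpha : G).
Hypothesis cs : centrally_symmetric_polytope tau alpha.
Variable s : nat.

Definition diagram_matrix (F F' : vertex tau) : nat :=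
  (if F == F' then 1 else if F' == vtrans alpha F then s else 2)%N.

Definition diagram_group := pres (coxeter_relators diagram_matrix).
HB.instance Definition _ := Group.on diagram_group.

Definition dact (g : G) (w : diagram_group) : diagram_group :=
  pcls _ (wmap (vtrans g) (repr w)).

Lemma vtrans_inj g : injective (@vtrans G n tau g).
Proof.
by apply: (can_inj (g := vtrans g^-1)) => F; rewrite vtransM mulgV vtrans1.
Qed.

Lemma diagram_matrix_vtrans g F F' :
  diagram_matrix (vtrans g F) (vtrans g F') = diagram_matrix F F'.
Proof.
rewrite /diagram_matrix (inj_eq (@vtrans_inj g)) vtransM.
by rewrite -(csp_central cs g) -vtransM (inj_eq (@vtrans_inj g)).
Qed.

Lemma wmap_vtrans g (u v : word (vertex tau)) :
  pres_eq (coxeter_relators diagram_matrix) u v ->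
  pres_eq (coxeter_relators diagram_matrix)
    (wmap (vtrans g) u) (wmap (vtrans g) v).
Proof.
apply: pres_wmap => _ [[F F'] _ <-] /=.
exists (vtrans g F, vtrans g F') => //=; rewrite diagram_matrix_vtrans.
by rewrite /wpow /wmap map_flatten map_nseq.
Qed.

Lemma dact_pcls g w :
  dact g (pcls _ w) = pcls _ (wmap (vtrans g) w).
Proof. by apply/pcls_eq/wmap_vtrans/repr_pcls. Qed.

Lemma dact1 w : dact 1 w = w.
Proof.
rewrite -[w](pcls_repr (R := coxeter_relators diagram_matrix)) dact_pcls.
congr pcls; rewrite -[RHS]map_id; apply: eq_map => -[F b] /=.
by rewrite vtrans1.
Qed.

Lemma dactM g h w : dact (g * h) w = dact h (dact g w).
Proof.
rewrite -[w](pcls_repr (R := coxeter_relators diagram_matrix)) !dact_pcls.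
congr pcls; rewrite /wmap -map_comp; apply: eq_map => -[F b] /=.
by rewrite vtransM.
Qed.

Lemma dactJ g w w' : dact g (w * w') = dact g w * dact g w'.
Proof.
rewrite -[w](pcls_repr (R := coxeter_relators diagram_matrix)).
rewrite -[w'](pcls_repr (R := coxeter_relators diagram_matrix)).
by rewrite -[_ * _ in LHS]pclsM !dact_pcls /wmap map_cat pclsM.
Qed.

Definition diagram_action : autaction G diagram_group :=
  AutAction dact1 dactM dactJ.

Definition twist_group := sdprod_of diagram_action.
HB.instance Definition _ := Group.on twist_group.

Definition twist_gen (i : 'I_n.+1) : twist_group :=
  if unlift ord0 i is Some j then (tau j, 1)
  else (1, pgen _ (base_vertex tau)).

End Twisting.

Section Cube.
Variable n : nat.

Definition cube_type : seq nat := 4 :: nseq (n - 2) 3.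

Definition cube_group := pres (coxeter_relators (string_matrix n cube_type)).
HB.instance Definition _ := Group.on cube_group.

Definition cube_gen (i : 'I_n) : cube_group := pgen _ i.

Definition cube_center : cube_group := (\prod_(i < n) cube_gen i) ^+ n.

End Cube.

Arguments cube_gen : clear implicits.

Section Relators.
Variables n s : nat.

Definition w_rho0 : word 'I_n.+1 := wgen ord0.

(* rho_1 rho_2 ... rho_n *)
Definition w_beta : word 'I_n.+1 :=
  flatten [seq wgen (lift ord0 j) | j <- enum 'I_n].

Definition extra_relators : set (word 'I_n.+1) :=
  [set wpow (w_rho0 ++ winv (wpow w_beta i) ++ w_rho0 ++ wpow w_beta i) 2
    | i in [set i : nat | (2 <= i <= n - 1)%N]] `|`
  [set wpow (w_rho0 ++ wpow w_beta n ++ w_rho0 ++ wpow w_beta n) s].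

End Relators.

Arguments extra_relators : clear implicits.

(* The regular map {4,4}_{(k,0)}. *)
Definition torus_relators (k : nat) : set (word 'I_3) :=
  let x (i : nat) : word 'I_3 := wgen (inord i) in
  coxeter_relators (string_matrix 3 [:: 4; 4]) `|`
  [set wpow (x 0%N ++ x 1%N ++ x 2%N ++ x 1%N) k].

(* Main.v *)
Require Import Defs.
From HB Require Import structures.
From mathcomp Require Import all_boot all_fingroup all_solvable.
From mathcomp Require Import boolp classical_sets functions cardinality.
From mathcomp Require Import generic_quotient zify.

(** The group of the n-cube is studied through its action on signed points, the
coordinate vectors and their negatives. Its elements factor along the chain of
the subgroups generated by the first 0, 1, ..., n generators, with 2(k+1) coset
representatives from rank k to rank k+1; their products with the generators are
controlled by [coset_rep_step]. A representative is known from the image of the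
last coordinate vector. Hence the action is faithful, the order is 2^n n!, and a
standard parabolic subgroup consists of the elements that preserve the faces of
the base flag whose generators it omits [parabolicP]. This gives the
intersection property of the cube group, and identifies the vertices of the cube
with sign vectors; the n-th power of the Coxeter element changes all signs.

The vertices form 2^(n-1) antipodal pairs. In the group W generated by the
involutions attached to them, involutions of distinct pairs commute and those of
a pair generate a dihedral group of order 2s, so that W is a power of this
dihedral group [dihedral_power].

In the semidirect product, a set I of generators generates the pairs (g, w)
where g runs over a parabolic subgroup of the cube group and w over the subgroup
of W attached to the orbit of the base vertex under it, or to the empty set if I
omits the generator of index 0 [twist_generated]. These orbits form a chain
[base_orbit_chain], so the intersection property reduces to that of the cube.

For the presentation, let P be the presented group. Its generators of positive
index satisfy the relations of the cube group, whence a morphism phi from that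
group to P. The conjugate of the generator of index 0 by phi g depends only on
the vertex to which g moves the base vertex F0, because that generator commutes
with the generators of index at least 2. Up to the action of the group, a pair
of vertices has the form (F0, F0 beta^i): the stabilizer of F0 permutes the
coordinates, and i is the number of negative signs [double_coset_beta]. Thus the
Coxeter relation of order 4 (for i = 1) and the extra relations (for i > 1) give
all the relations of W, and phi extends to an inverse of the canonical morphism
from P to the semidirect product [twist_presented].

In the group of the toroidal map, every element is the product of involutions
taken from four commuting ones, attached to the vertices of a square, and of an
element of the dihedral group of order 8 of the square [torus_eltM]. As n is at
least 3, no two vertices of the square are antipodal in the cube, and the images
of these products are distinct [torus_presented]. *)

Set Implicit Arguments.
Unset Strict Implicit.
Unset Printing Implicit Defensive.

Local Open Scope classical_set_scope.
Local Open Scope group_scope.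

(* The name also denotes the subgroup generated by a subset of a finite group. *)
Local Notation generated := Defs.generated.

(** * Groups and their morphisms *)

Section GroupMorphisms.
Variables (G H : groupType) (f : G -> H).
Hypothesis fM : {morph f : x y / x * y}.

Lemma gmorph1 : f 1 = 1.
Proof. by apply: (mulgI (f 1)); rewrite -fM !mulg1. Qed.

Lemma gmorphV x : f x^-1 = (f x)^-1.
Proof. by apply: (mulgI (f x)); rewrite -fM !mulgV gmorph1. Qed.

Lemma gmorphX x k : f (x ^+ k) = f x ^+ k.
Proof. by elim: k => [|k IHk]; rewrite ?gmorph1 // !expgS fM IHk. Qed.

Lemma gmorphJ x y : f (x ^ y) = f x ^ f y.
Proof. by rewrite !conjgE !fM gmorphV. Qed.

Lemma gmorph_inj : (forall x, f x = 1 -> x = 1) -> injective f.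
Proof. by move=> f1 x y xy; apply/divg1_eq/f1; rewrite fM gmorphV xy mulgV. Qed.

End GroupMorphisms.

Lemma inj_surj_bijective (A B : Type) (f : A -> B) :
  injective f -> (forall y, exists x, f x = y) -> bijective f.
Proof.
move=> f_inj f_surj; have gP y := svalP (cid (f_surj y)).
by exists (fun y => sval (cid (f_surj y))) => x; [apply: f_inj; rewrite gP|].
Qed.

Lemma multiplicative_of_morph (G H : groupType) (f : G -> H) :
  {morph f : x y / x * y} -> exists F : {multiplicative G -> H}, F = f :> (G -> H).
Proof.
move=> fM; pose m := isMultiplicative.Build G H f fM.
by exists (HB.pack_for {multiplicative G -> H} f m).
Qed.

Lemma card_eq_bijective (T : Type) (U : finType) (f : T -> U) :
  bijective f -> ([set: T] #= `I_#|U|)%card.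
Proof.
case=> g fK gK; apply/card_set_bijP; exists (fun x => enum_rank (f x) : nat).
split=> [x _|x y _ _ /val_inj/enum_rank_inj/(can_inj fK) //|i lti]; first exact: ltn_ord.
exists (g (enum_val (Ordinal lti))) => //; by rewrite gK enum_valK.
Qed.

Lemma involV (G : groupType) (x : G) : x * x = 1 -> x^-1 = x.
Proof. exact: mulg1_eq. Qed.

Lemma has_order_prime_power (G : groupType) (x : G) (p e : nat) : prime p ->
  x ^+ (p ^ e)%N != 1 -> x ^+ (p ^ e.+1)%N = 1 -> has_order x (p ^ e.+1).
Proof.
move=> p_pr /eqP xpe xpe1 j; split; last first.
  by case/dvdnP=> k ->; rewrite mulnC expgnA xpe1 expg1n.
move=> xj; have /(dvdn_pfactor _ _ p_pr)[k lek Dk] := dvdn_gcdl (p ^ e.+1) j.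
have xg : x ^+ (p ^ k)%N = 1.
  have p0 : (0 < p ^ e.+1)%N by rewrite expn_gt0 prime_gt0.
  have [u _] := Bezoutl j p0; rewrite Dk => /dvdnP[v Duv].
  have: x ^+ (p ^ k + u * j)%N = 1 by rewrite Duv mulnC expgnA xpe1 expg1n.
  by rewrite expgnDr [(u * j)%N]mulnC expgnA xj expg1n mulg1.
have: (k == e.+1) || (k <= e)%N by rewrite -leq_eqVlt.
case/orP=> [/eqP k_e|lek1]; first by rewrite -k_e -Dk dvdn_gcdr.
by case: xpe; rewrite -(subnKC lek1) expnD expgnA xg expg1n.
Qed.

(** * Generated subgroups *)

Section Generated.
Variable G : groupType.
Implicit Types A B : set G.

Lemma generated_subgroup A : is_subgroup (generated A).
Proof.
split=> [|x y Ax Ay] B HB; first by case: HB => -[].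
by case: (HB) => -[_ BV] _; apply: BV; [exact: Ax|exact: Ay].
Qed.

Lemma generated_sub A B : is_subgroup B -> A `<=` B -> generated A `<=` B.
Proof. exact: smallest_sub. Qed.

Lemma mem_generated A x : A x -> generated A x.
Proof. exact: sub_gen_smallest. Qed.

Lemma generated1 A : generated A 1.
Proof. by case: (generated_subgroup A). Qed.

Lemma generatedV A x : generated A x -> generated A x^-1.
Proof.
case: (generated_subgroup A) => A1 AV Ax; rewrite -[x^-1]mul1g; exact: AV.
Qed.

Lemma generatedM A x y : generated A x -> generated A y -> generated A (x * y).
Proof.
move=> Ax /generatedV Ay; rewrite -[y]invgK.
by case: (generated_subgroup A) => _; apply.
Qed.

Lemma generated_mono A B : A `<=` B -> generated A `<=` generated B.
Proof. by move=> AB; apply: sub_smallest2r => //; exact: generated_subgroup. Qed.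

(** When the generators are involutions, multiplication on the right by
generators reaches the whole subgroup, without inverses. *)
Lemma generated_ind A (P : G -> Prop) : (forall a, A a -> a * a = 1) ->
  P 1 -> (forall x a, P x -> A a -> P (x * a)) -> forall x, generated A x -> P x.
Proof.
move=> A2 P1 PM x Ax; rewrite -[x]mul1g.
pose B z := (forall y, P y -> P (y * z)) /\ (forall y, P y -> P (y * z^-1)).
suff [Px _] : B x by exact: Px.
apply: Ax; split.
  split=> [|u v [Pu Pu'] [Pv Pv']]; first by split=> y; rewrite ?invg1 mulg1.
  split=> y Py; first by rewrite mulgA; apply/Pv'/Pu.
  by rewrite invgF mulgA; apply/Pu'/Pv.
by move=> a Aa; split=> y Py; rewrite ?(involV (A2 _ Aa)); exact: PM.
Qed.

End Generated.

Lemma generated_image (G H : groupType) (f : G -> H) (A : set G) :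
  {morph f : x y / x * y} ->
  forall x, generated A x -> generated (f @` A) (f x).
Proof.
move=> fM x; apply: (@generated_sub _ A (fun x => generated (f @` A) (f x))).
  split=> [|u v]; first by rewrite gmorph1 //; exact: generated1.
  by rewrite fM gmorphV // => Au /generatedV; exact: generatedM.
by move=> a Aa; apply: mem_generated; exists a.
Qed.

(** * Presented groups *)

Section WordEvaluation.
Variables (I : Type) (G : groupType) (g : I -> G).

Definition weval (w : word I) : G := \prod_(x <- w) (if x.2 then (g x.1)^-1 else g x.1).

Lemma weval_nil : weval [::] = 1. Proof. exact: big_nil. Qed.
Lemma weval_cat u v : weval (u ++ v) = weval u * weval v.
Proof. exact: big_cat. Qed.
Lemma weval_gen i : weval (wgen i) = g i. Proof. exact: big_seq1. Qed.

Lemma weval_inv w : weval (winv w) = (weval w)^-1.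
Proof.
elim: w => [|[i b] w IHw]; first by rewrite weval_nil invg1.
rewrite -cat1s winv_cat !weval_cat IHw invgM; congr (_ * _).
by rewrite /winv /weval /= !big_seq1 /=; case: b; rewrite ?invgK.
Qed.

Lemma weval_pow w k : weval (wpow w k) = weval w ^+ k.
Proof.
by elim: k => [|k IHk]; rewrite /wpow /= ?weval_nil // weval_cat expgS IHk.
Qed.

Lemma weval_pres (R : set (word I)) u v : (forall r, R r -> weval r = 1) ->
  pres_eq R u v -> weval u = weval v.
Proof.
move=> R1; elim=> {u v} [//|//|u v w _ -> _ -> //|u v i b|u v r Rr].
  rewrite !weval_cat; congr (_ * _); rewrite -[RHS]mul1g; congr (_ * _).
  by rewrite /weval big_cons big_seq1 /=; case: b; rewrite /= ?mulgV ?mulVg.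
by rewrite !weval_cat (R1 _ Rr) mul1g.
Qed.

End WordEvaluation.

Section PresentedGroupTheory.
Variables (I : choiceType) (R : set (word I)).

Lemma pres_ind (P : pres R -> Prop) : P 1 ->
  (forall x i, P x -> P (x * pgen R i)) ->
  (forall x i, P x -> P (x * (pgen R i)^-1)) -> forall x, P x.
Proof.
move=> P1 PM PV x; rewrite -[x]pcls_repr.
elim/last_ind: (repr x) => [//|w [i b] IHw]; rewrite -cats1 pclsM.
case: b; last exact: PM.
by have := PV _ i IHw; rewrite -[(pgen R i)^-1](@pclsV _ R (wgen i)).
Qed.

Lemma pcls_weval w : pcls R w = weval (pgen R) w.
Proof.
elim: w => [|[i b] w IHw]; first by rewrite weval_nil.
rewrite -cat1s weval_cat pclsM IHw; congr (_ * _).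
by rewrite /weval big_seq1; case: b => //=; rewrite -[RHS]pclsV.
Qed.

Lemma pres_relator r : R r -> weval (pgen R) r = 1.
Proof.
move=> Rr; rewrite -pcls_weval; apply/pcls_eq.
by have := pres_rel [::] [::] Rr; rewrite cats0.
Qed.

Lemma pres_hom_eq (G : groupType) (f g : pres R -> G) :
  {morph f : x y / x * y} -> {morph g : x y / x * y} ->
  (forall i, f (pgen R i) = g (pgen R i)) -> f =1 g.
Proof.
move=> fM gM fg; apply: pres_ind => [|x i Ex|x i Ex]; first by rewrite !gmorph1.
  by rewrite fM gM fg Ex.
by rewrite fM gM (gmorphV fM) (gmorphV gM) fg Ex.
Qed.

Lemma generated_pgen : generated (range (pgen R)) = [set: pres R].
Proof.
apply/seteqP; split=> // x _; elim/pres_ind: x => [|x i Ax|x i Ax].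
- exact: generated1.
- by apply: generatedM Ax _; apply: mem_generated; exists i.
- by apply: generatedM Ax (generatedV _); apply: mem_generated; exists i.
Qed.

Section Lift.
Variables (G : groupType) (g : I -> G).
Hypothesis R1 : forall r, R r -> weval g r = 1.

(** The universal property of a presentation. *)
Definition plift (x : pres R) : G := let _ := R1 in weval g (repr x).

Lemma plift_pcls w : plift (pcls R w) = weval g w.
Proof. exact/(weval_pres R1)/repr_pcls. Qed.

Lemma pliftM : {morph plift : x y / x * y}.
Proof.
move=> x y; rewrite -[x]pcls_repr -[y]pcls_repr -[_ * _ in LHS]pclsM.
by rewrite !plift_pcls weval_cat.
Qed.
HB.instance Definition _ := isMultiplicative.Build (pres R) G plift pliftM.

Lemma plift_gen i : plift (pgen R i) = g i.
Proof. by rewrite plift_pcls weval_gen. Qed.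

Lemma presented_by_ker : (forall x, plift x = 1 -> x = 1) -> presented_by g R.
Proof.
by move=> ker1; exists plift; split; [apply: gmorph_inj pliftM ker1|exact: plift_gen].
Qed.

End Lift.
End PresentedGroupTheory.

Section CoxeterPresentation.
Variables (I : choiceType) (M : I -> I -> nat).

Lemma coxeter_weval (G : groupType) (g : I -> G) :
  (forall i j, (g i * g j) ^+ M i j = 1) ->
  forall r, coxeter_relators M r -> weval g r = 1.
Proof.
by move=> gM _ [[i j] _ <-]; rewrite weval_pow weval_cat !weval_gen gM.
Qed.

Lemma coxeter_rel (R : set (word I)) i j : coxeter_relators M `<=` R ->
  (pgen R i * pgen R j) ^+ M i j = 1.
Proof.
move=> MR; rewrite -[RHS](@pres_relator _ R (wpow (wgen i ++ wgen j) (M i j))).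
  by rewrite weval_pow weval_cat !weval_gen.
by apply: MR; exists (i, j).
Qed.

Lemma coxeter_invol (R : set (word I)) i : coxeter_relators M `<=` R ->
  M i i = 1%N -> pgen R i * pgen R i = 1.
Proof. by move=> /(@coxeter_rel R i i) + Mi; rewrite Mi. Qed.

End CoxeterPresentation.

(** The inverse of a generator that is an involution is a generator. *)
Lemma invol_pres_ind (I : choiceType) (R : set (word I)) (P : pres R -> Prop) :
  (forall i, pgen R i * pgen R i = 1) ->
  P 1 -> (forall x i, P x -> P (x * pgen R i)) -> forall x, P x.
Proof.
move=> R2 P1 PM; apply: pres_ind => // x i Px; rewrite (involV (R2 i)); exact: PM.
Qed.

(** * Signed points *)

Definition adj_swap (i p : nat) : nat :=
  if p == i then i.+1 else if p == i.+1 then i else p.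

(** The pair (p, b) stands for the p-th coordinate vector, negated when b holds;
the reflections of the cube act on these vectors. *)
Definition spoint_act (i : nat) (x : nat * bool) : nat * bool :=
  if i is j.+1 then (adj_swap j x.1, x.2) else (x.1, x.2 (+) (x.1 == 0)).

Lemma adj_swapK i p : adj_swap i (adj_swap i p) = p.
Proof. rewrite /adj_swap; do ?case: eqP; lia. Qed.

Lemma adj_swap_far i j p : (i.+1 < j)%N ->
  adj_swap i (adj_swap j p) = adj_swap j (adj_swap i p).
Proof. move=> ij; rewrite /adj_swap; do ?case: eqP; lia. Qed.

Lemma adj_swap_braid i p :
  adj_swap i (adj_swap i.+1 (adj_swap i p)) =
  adj_swap i.+1 (adj_swap i (adj_swap i.+1 p)).
Proof. rewrite /adj_swap; do ?case: eqP; lia. Qed.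

Lemma spoint_actK i : involutive (spoint_act i).
Proof.
by case: i => [|i] [p b]; rewrite /spoint_act /= ?adj_swapK // -addbA addbb addbF.
Qed.

Lemma spoint_act_far i j x : (i.+1 < j)%N ->
  spoint_act i (spoint_act j x) = spoint_act j (spoint_act i x).
Proof.
case: j => // j ij; case: i ij => [|i] ij; rewrite /spoint_act /=; last first.
  by rewrite adj_swap_far.
by congr (_, _ (+) _); rewrite /adj_swap; do ?case: eqP; lia.
Qed.

Lemma spoint_actN i p b : spoint_act i (p, ~~ b) =
  ((spoint_act i (p, b)).1, ~~ (spoint_act i (p, b)).2).
Proof. by case: i => [|i] //=; rewrite addNb. Qed.

(** * Coset representatives for the signed permutation groups *)

Section HyperoctahedralNormalForm.
Variables (G : groupType) (n : nat) (t : nat -> G).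
Hypothesis t2 : forall i, t i * t i = 1.
Hypothesis t_far : forall i j, (i.+1 < j)%N -> t i * t j = t j * t i.
Hypothesis t_braid : forall i, (0 < i)%N -> (i.+1 < n)%N ->
  t i * t i.+1 * t i = t i.+1 * t i * t i.+1.
Hypothesis t_braid01 : (1 < n)%N -> t 0 * t 1 * t 0 * t 1 = t 1 * t 0 * t 1 * t 0.

(** The product t_(a+l-1) ... t_(a+1) t_a. *)
Fixpoint descent (a l : nat) : G := if l is l'.+1 then t (a + l') * descent a l' else 1.

Arguments descent : simpl never.

Definition ascent (a l : nat) : G := (descent a l)^-1.

Lemma tV i : (t i)^-1 = t i. Proof. exact: involV. Qed.

Lemma mulgtt x i : x * t i * t i = x. Proof. by rewrite -mulgA t2 mulg1. Qed.

Lemma descentS a l : descent a l.+1 = t (a + l) * descent a l. Proof. by []. Qed.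

Lemma descentSr a l : descent a l.+1 = descent a.+1 l * t a.
Proof.
elim: l => [|l IHl]; first by rewrite descentS addn0 mulg1 mul1g.
by rewrite [in RHS]descentS -mulgA -IHl addSnnS.
Qed.

Lemma ascent0 a : ascent a 0 = 1. Proof. exact: invg1. Qed.

Lemma ascentS a l : ascent a l.+1 = ascent a l * t (a + l).
Proof. by rewrite /ascent descentS invgM tV. Qed.

Lemma ascentSl a l : ascent a l.+1 = t a * ascent a.+1 l.
Proof. by rewrite /ascent descentSr invgM tV. Qed.

Lemma commute_descent a l i : (i.+1 < a)%N || (a + l < i)%N ->
  commute (t i) (descent a l).
Proof.
elim: l => [|l IHl] il; first exact: commute1.
apply: commuteM; last by apply: IHl; lia.
by case/orP: il => il; [apply: t_far|apply/esym/t_far]; lia.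
Qed.

Lemma commute_ascent a l i : (i.+1 < a)%N || (a + l < i)%N ->
  commute (t i) (ascent a l).
Proof. by move=> il; apply/commuteV/commute_descent. Qed.

(** The generator of index i.+1 commutes with the factors on its left until it
meets those of indices i.+1 and i, where the braid relation turns it into the
generator of index i, which commutes with the remaining factors. *)
Lemma descent_shift a l i : (a <= i)%N -> (0 < i)%N -> (i.+1 < a + l)%N ->
  (a + l <= n)%N -> descent a l * t i.+1 = t i * descent a l.
Proof.
move=> ai i0; elim: l => [|l IHl] il ln; first lia.
have [il1|il1] := ltnP i.+1 (a + l).
  rewrite descentS -mulgA IHl //; last lia.
  by rewrite !mulgA -t_far //; lia.
case: l {IHl} il ln il1 => [|l] il ln il1; first lia.
have Di : i = (a + l)%N by lia.
rewrite !descentS addnS -Di -!mulgA -commute_descent; last lia.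
by rewrite !mulgA t_braid //; lia.
Qed.

Lemma ascent_shift a l i : (a <= i)%N -> (0 < i)%N -> (i.+1 < a + l)%N ->
  (a + l <= n)%N -> ascent a l * t i = t i.+1 * ascent a l.
Proof.
move=> ai i0 il ln; apply: invg_inj.
by rewrite !invgM invgK !tV descent_shift.
Qed.

(** The representative of the coset of the rank k subgroup, in the rank k.+1
subgroup, whose elements send the last coordinate vector k to x. *)
Definition coset_rep (k : nat) (x : nat * bool) : G :=
  if x.2 then descent 0 k.+1 * ascent 1 x.1 else descent x.1.+1 (k - x.1).

Lemma coset_rep_pos k p : coset_rep k (p, false) = descent p.+1 (k - p).
Proof. by []. Qed.

Lemma coset_rep_neg k p : coset_rep k (p, true) = descent 0 k.+1 * ascent 1 p.
Proof. by []. Qed.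

Lemma coset_rep_id k : coset_rep k (k, false) = 1.
Proof. by rewrite /coset_rep /= subnn. Qed.

(** The Schreier graph of the cosets is the action on signed points; the loops
are labelled by generators of the smaller subgroup. *)
Lemma coset_rep_step k x i : (k < n)%N -> (i <= k)%N -> (x.1 <= k)%N ->
  coset_rep k x * t i = coset_rep k (spoint_act i x) \/
  exists2 j, (j < k)%N & coset_rep k x * t i = t j * coset_rep k x.
Proof.
case: x => p [] kn ik /= pk; rewrite /coset_rep /=.
  case: i ik => [|i] ik /=.
    case: p pk => [|p] pk.
      by left; rewrite ascent0 mulg1 subn0 descentSr mulgtt.
    right; exists 0%N; first lia.
    case: k kn pk ik => // k kn pk _.
    have cD := @commute_descent 2 k 0 isT; have cU := @commute_ascent 2 p 0 isT.
    rewrite ascentSl !descentSr -!mulgA -cU !mulgA cD -!mulgA; congr (_ * _).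
    by rewrite !mulgA t_braid01 //; lia.
  have [pi|pi] := ltnP p i.
    right; exists i; first lia.
    rewrite -mulgA -commute_ascent; last lia.
    by rewrite 2!mulgA descent_shift //; lia.
  have [Di|ip] := eqVneq p i.
    by left; rewrite /adj_swap Di eqxx ascentS mulgA.
  rewrite /adj_swap (negPf ip); have [->|ip1] := eqVneq p i.+1.
    by left; rewrite ascentS add1n mulgA mulgtt.
  right; exists i.+1; first lia.
  rewrite -mulgA ascent_shift; try lia.
  by rewrite 2!mulgA descent_shift //; lia.
have [pi|pi] := ltnP p.+1 i.
  right; exists i.-1; first lia.
  by case: i ik pi => // i ik pi; rewrite descent_shift //; lia.
have [Di|pi1] := eqVneq i p.+1.
  left; have pk' : (p < k)%N by rewrite -Di.
  by rewrite Di /= /adj_swap eqxx -(subnSK pk') descentSr mulgtt.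
have [Di|ip] := eqVneq i p; last first.
  right; exists i; first lia.
  by rewrite -commute_descent //; lia.
left; case: p pi pi1 Di pk ik => [|p] pi pi1 -> pk ik /=.
  by rewrite ascent0 mulg1 subn0 -descentSr.
rewrite /adj_swap gtn_eqF // eqxx -descentSr; congr descent; lia.
Qed.

(** The elements of the subgroup of rank k, factored along the chain of the
subgroups of smaller rank. *)
Fixpoint normal_form (k : nat) (x : G) : Prop :=
  if k is k'.+1 then
    exists2 h, normal_form k' h & exists2 y, (y.1 < k)%N & x = h * coset_rep k' y
  else x = 1.

Lemma normal_form1 k : normal_form k 1.
Proof.
elim: k => //= k IHk; exists 1 => //; exists (k, false) => //=.
by rewrite coset_rep_id mulg1.
Qed.

Lemma spoint_act_lt i k x : (i <= k)%N -> (x.1 <= k)%N -> ((spoint_act i x).1 <= k)%N.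
Proof. by case: i => [|i] //= ik xk; rewrite /adj_swap; do ?case: eqP; lia. Qed.

Lemma normal_formM k x i : (k <= n)%N -> (i < k)%N ->
  normal_form k x -> normal_form k (x * t i).
Proof.
elim: k x i => // k IHk x i kn ik [h Hh [y yk ->]].
have [|[j jk]] := coset_rep_step kn ik yk; rewrite -mulgA => ->.
  by exists h => //; exists (spoint_act i y) => //; apply: spoint_act_lt.
by exists (h * t j); [apply: IHk => //; apply: ltnW|exists y; rewrite ?mulgA].
Qed.

End HyperoctahedralNormalForm.

Arguments descent {G} t a l : simpl never.

(** * Coxeter relations *)

Section InvolutionRelations.
Variables (G : groupType) (x y : G).
Hypotheses (x2 : x * x = 1) (y2 : y * y = 1).

Lemma invol_commute : (x * y) ^+ 2 = 1 -> x * y = y * x.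
Proof.
rewrite expg2 => /mulg1_eq; rewrite invgM (involV x2) (involV y2).
by move=> ->.
Qed.

Lemma invol_braid3 : (x * y) ^+ 3 = 1 -> x * y * x = y * x * y.
Proof.
have -> : (x * y) ^+ 3 = (x * y * x) * (y * x * y) by rewrite !expgS expg0 mulg1 !mulgA.
by move/mulg1_eq => <-; rewrite !invgM (involV x2) (involV y2) mulgA.
Qed.

Lemma invol_braid4 : (x * y) ^+ 4 = 1 -> x * y * x * y = y * x * y * x.
Proof.
have -> : (x * y) ^+ 4 = (x * y * x * y) * (x * y * x * y).
  by rewrite !expgS expg0 mulg1 !mulgA.
by move/mulg1_eq => <-; rewrite !invgM (involV x2) (involV y2) !mulgA.
Qed.

End InvolutionRelations.

Lemma string_matrix_diag m p i : string_matrix m p i i = 1%N.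
Proof. by rewrite /string_matrix eqxx. Qed.

Lemma string_matrix_next m p (i j : 'I_m) : j = i.+1 :> nat ->
  string_matrix m p i j = nth 0%N p i.
Proof. by move=> ij; rewrite /string_matrix -val_eqE /=; do 3?case: eqP => [?|?] //; lia. Qed.

Lemma string_matrix_prev m p (i j : 'I_m) : i = j.+1 :> nat ->
  string_matrix m p i j = nth 0%N p j.
Proof.
by move=> ij; rewrite /string_matrix -val_eqE /=; do 3?case: eqP => [?|?] //; lia.
Qed.

Lemma string_matrix_far m p (i j : 'I_m) : (i.+1 < j)%N || (j.+1 < i)%N ->
  string_matrix m p i j = 2.
Proof.
by move=> ij; rewrite /string_matrix -val_eqE /=; do 3?case: eqP => [?|?] //; lia.
Qed.

Lemma string_matrix_lift m p0 p (i j : 'I_m) :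
  string_matrix m.+1 (p0 :: p) (lift ord0 i) (lift ord0 j) = string_matrix m p i j.
Proof. by rewrite /string_matrix (inj_eq lift_inj) !lift0 /= !eqSS. Qed.

(** For involutions, the relation of the pair (j, i) is the inverse of the
relation of the pair (i, j). *)
Lemma string_relations (G : groupType) m p (g : 'I_m -> G) :
  (forall i, g i * g i = 1) ->
  (forall i j : 'I_m, j = i.+1 :> nat -> (g i * g j) ^+ nth 0%N p i = 1) ->
  (forall i j : 'I_m, (i.+1 < j)%N -> (g i * g j) ^+ 2 = 1) ->
  forall i j, (g i * g j) ^+ string_matrix m p i j = 1.
Proof.
move=> g2 g_next g_far i j; have gV i0 : (g i0)^-1 = g i0 by exact: involV.
have sym k : (g j * g i) ^+ k = 1 -> (g i * g j) ^+ k = 1.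
  by move=> E; apply: invg_inj; rewrite invg1 -expVgn invgM !gV.
have [ij|ij|ij] := ltngtP i j.
- have [ij1|ij1] := eqVneq (j : nat) i.+1.
    by rewrite string_matrix_next // g_next.
  by rewrite string_matrix_far ?g_far //; lia.
- have [ij1|ij1] := eqVneq (i : nat) j.+1.
    by apply: sym; rewrite string_matrix_prev // g_next.
  by apply: sym; rewrite string_matrix_far ?g_far //; lia.
- by rewrite (val_inj ij) string_matrix_diag expg1.
Qed.

(** * The action of the cube group on signed points *)

Section CubeGroup.
Variable n : nat.
Hypothesis n2 : (2 <= n)%N.

Notation CG := (cube_group n).

Lemma cube_rel i j :
  (cube_gen n i * cube_gen n j) ^+ string_matrix n (cube_type n) i j = 1.
Proof. exact: coxeter_rel. Qed.

Lemma cube_gen2 i : cube_gen n i * cube_gen n i = 1.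
Proof. by have := cube_rel i i; rewrite string_matrix_diag. Qed.

Lemma cube_group_ind (P : CG -> Prop) :
  P 1 -> (forall x i, P x -> P (x * cube_gen n i)) -> forall x, P x.
Proof. exact: (invol_pres_ind cube_gen2). Qed.

Lemma cube_type_nth i : (i.+1 < n)%N -> nth 0%N (cube_type n) i = if i is 0 then 4 else 3.
Proof. by case: i => //= i lti; rewrite nth_nseq; case: ifP => //; lia. Qed.

Definition spoint_word (w : word 'I_n) x := foldl (fun y a => spoint_act (val a.1) y) x w.

Lemma spoint_word_cat u v x : spoint_word (u ++ v) x = spoint_word v (spoint_word u x).
Proof. exact: foldl_cat. Qed.

Lemma spoint_word_relator r x : coxeter_relators (string_matrix n (cube_type n)) r ->
  spoint_word r x = x.
Proof.
case=> -[i j] _ <-; have -> k : spoint_word (wpow (wgen i ++ wgen j) k) x =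
    iter k (spoint_act j \o spoint_act i) x.
  elim: k x => // k IHk x.
  by rewrite iterSr -IHk /wpow /= -/(wpow _ _).
rewrite [(i, j).1]/= [(i, j).2]/=; wlog ij : i j x / (i <= j)%N.
  move=> IH; have [ij|/ltnW ji] := leqP i j; first exact: IH.
  have -> : string_matrix n (cube_type n) i j = string_matrix n (cube_type n) j i.
    rewrite /string_matrix eq_sym; case: eqP => // _.
    by case: eqP => [?|_]; case: eqP => [?|_] //; lia.
  move: (IH j i x ji); move: (string_matrix _ _ _ _) => k.
  set f := _ \o _; set f' := _ \o _ => fk.
  suff fK y : f' (f y) = y.
    have fkK m y : iter m f' (iter m f y) = y.
      by elim: m y => // m IHm y; rewrite iterS iterSr IHm.
    by rewrite -[X in iter _ _ X]fk fkK.
  by rewrite /f /f' /= !spoint_actK.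
have [ij1|ij1] := eqVneq (j : nat) i.+1.
  rewrite string_matrix_next // cube_type_nth; last by have := ltn_ord j; lia.
  rewrite ij1; case: (nat_of_ord i) => [|k]; case: x => p b.
    by case: p => [|[|p]]; case: b.
  by rewrite /= !adj_swap_braid !adj_swapK.
have [ij2|ij2] := eqVneq (i : nat) j.
  by rewrite (val_inj ij2) string_matrix_diag /= spoint_actK.
rewrite string_matrix_far /=; last lia.
by rewrite -!(@spoint_act_far i j) ?spoint_actK //; lia.
Qed.

Lemma spoint_word_pres u v :
  pres_eq (coxeter_relators (string_matrix n (cube_type n))) u v ->
  spoint_word u =1 spoint_word v.
Proof.
elim=> {u v} [//|u v _ IH x|u v w _ IHu _ IHv x|u v i b x|u v r Rr x].
- by rewrite IH.
- by rewrite IHu IHv.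
- by rewrite !spoint_word_cat /= spoint_actK.
- by rewrite !spoint_word_cat (spoint_word_relator _ Rr).
Qed.

Definition gact (g : CG) (x : nat * bool) : nat * bool := spoint_word (repr g) x.

Lemma gact_pcls w x : gact (pcls _ w) x = spoint_word w x.
Proof. exact/spoint_word_pres/repr_pcls. Qed.

Lemma gact1 x : gact 1 x = x. Proof. exact: (gact_pcls [::]). Qed.

Lemma gactM g h x : gact (g * h) x = gact h (gact g x).
Proof.
by rewrite -[g]pcls_repr -[h]pcls_repr -[_ * _]pclsM !gact_pcls spoint_word_cat.
Qed.

Lemma gact_gen i x : gact (cube_gen n i) x = spoint_act i x.
Proof. exact: (gact_pcls (wgen i)). Qed.

Lemma gactK g x : gact g^-1 (gact g x) = x.
Proof. by rewrite -gactM mulgV gact1. Qed.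

Lemma gactVK g x : gact g (gact g^-1 x) = x.
Proof. by rewrite -gactM mulVg gact1. Qed.

Lemma gact_fixV g x : gact g x = x -> gact g^-1 x = x.
Proof. by move=> gx; rewrite -{1}gx gactK. Qed.

Lemma gactN g p b : gact g (p, ~~ b) = ((gact g (p, b)).1, ~~ (gact g (p, b)).2).
Proof.
elim/cube_group_ind: g => [|g i IHg]; first by rewrite !gact1.
by rewrite !gactM IHg; case: (gact g _) => q c; rewrite !gact_gen -spoint_actN.
Qed.

Lemma gact_signE g p b : (gact g (p, b)).2 = b (+) (gact g (p, false)).2.
Proof. by case: b; rewrite ?addFb // -[true]/(~~ false) gactN addTb. Qed.

(** Generators of index n or more are trivial, so that the commutation relations
hold for all natural indices. *)
Definition ctau (i : nat) : CG := if insub i is Some j then cube_gen n j else 1.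

Lemma ctauE (i : 'I_n) : ctau i = cube_gen n i.
Proof. by rewrite /ctau valK. Qed.

Lemma ctau_out i : (n <= i)%N -> ctau i = 1.
Proof. by move=> ni; rewrite /ctau insubF // ltnNge ni. Qed.

Lemma ctauP (i : nat) : (exists2 j : 'I_n, i = j :> nat & ctau i = cube_gen n j) \/
  (n <= i)%N /\ ctau i = 1.
Proof.
have [lti|ni] := ltnP i n; last by right; rewrite ctau_out.
by left; exists (Ordinal lti) => //; rewrite -ctauE.
Qed.

Lemma ctau2 i : ctau i * ctau i = 1.
Proof. by case: (ctauP i) => [[j _]|[_]] ->; rewrite ?mulg1 // cube_gen2. Qed.

Lemma ctau_far i j : (i.+1 < j)%N -> ctau i * ctau j = ctau j * ctau i.
Proof.
move=> ij; case: (ctauP i) => [[i' Di ->]|[_ ->]]; last by rewrite mulg1 mul1g.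
case: (ctauP j) => [[j' Dj ->]|[_ ->]]; last by rewrite mulg1 mul1g.
apply: invol_commute; rewrite ?cube_gen2 //; have := cube_rel i' j'.
by rewrite string_matrix_far // -Di -Dj ij.
Qed.

Lemma ctau_next i : (i.+1 < n)%N ->
  (ctau i * ctau i.+1) ^+ (if i is 0 then 4 else 3) = 1.
Proof.
move=> i1; have i0 : (i < n)%N by lia.
have := @cube_rel (Ordinal i0) (Ordinal i1).
by rewrite string_matrix_next // cube_type_nth // -!ctauE.
Qed.

Lemma ctau_braid i : (0 < i)%N -> (i.+1 < n)%N ->
  ctau i * ctau i.+1 * ctau i = ctau i.+1 * ctau i * ctau i.+1.
Proof.
case: i => // i _ i1; apply: invol_braid3; rewrite ?ctau2 //; exact: (ctau_next i1).
Qed.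

Lemma ctau_braid01 : (1 < n)%N ->
  ctau 0 * ctau 1 * ctau 0 * ctau 1 = ctau 1 * ctau 0 * ctau 1 * ctau 0.
Proof. by move=> n1; apply: invol_braid4; rewrite ?ctau2 //; exact: (ctau_next n1). Qed.

Notation descent := (descent ctau).
Notation ascent := (ascent ctau).
Notation coset_rep := (coset_rep ctau).
Notation normal_form := (normal_form ctau).

Lemma cube_normal_form g : normal_form n g.
Proof.
elim/cube_group_ind: g => [|g i IHg]; first exact: normal_form1.
rewrite -ctauE; apply: (normal_formM (n := n)) => //.
- exact: ctau2.
- exact: ctau_far.
- exact: ctau_braid.
- exact: ctau_braid01.
Qed.

Lemma gact_ctau i x : (i < n)%N -> gact (ctau i) x = spoint_act i x.
Proof. by move=> lti; rewrite -[i]/(val (Ordinal lti)) ctauE gact_gen. Qed.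

Lemma gact_ctau_fix i p b : (i < p)%N || (p.+1 < i)%N -> gact (ctau i) (p, b) = (p, b).
Proof.
case: (ctauP i) => [[j -> ->]|[_ ->]]; rewrite ?gact1 // gact_gen.
case: (nat_of_ord j) => [|k] /=; first by case: p => //= p _; rewrite addbF.
by rewrite /adj_swap; do 2?[case: eqP => [?|_]; first lia].
Qed.

Lemma gact_descent_fix a l p b : (a + l <= p)%N -> gact (descent a l) (p, b) = (p, b).
Proof.
elim: l => [|l IHl] al; first exact: gact1.
by rewrite descentS gactM gact_ctau_fix ?IHl //; lia.
Qed.

Lemma gact_descent a l b : (a + l < n)%N -> gact (descent a.+1 l) ((a + l)%N, b) = (a, b).
Proof.
elim: l => [|l IHl] al; first by rewrite addn0 gact1.
have al' : (a + l < n)%N by lia.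
rewrite addnS in al *; rewrite descentS gactM addSn gact_ctau //=.
by rewrite /adj_swap gtn_eqF // eqxx IHl.
Qed.

Lemma gact_ascent l b : (l < n)%N -> gact (ascent 1 l) (0%N, b) = (l, b).
Proof. by move=> ln; rewrite -(@gact_descent 0 l b) ?add0n // gactK. Qed.

Lemma gact_coset_rep k x : (x.1 <= k)%N -> (k < n)%N ->
  gact (coset_rep k x) (k, false) = x.
Proof.
case: x => p [] /= pk kn; rewrite ?coset_rep_pos ?coset_rep_neg.
  rewrite descentSr !gactM.
  rewrite -{2}[k]add0n gact_descent ?add0n // gact_ctau; last lia.
  by rewrite gact_ascent //; lia.
by rewrite -{2}(subnKC pk) gact_descent // subnKC.
Qed.

Lemma gact_normal_form_fix k h p b : normal_form k h -> (k <= p)%N ->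
  gact h (p, b) = (p, b).
Proof.
elim: k h => [|k IHk] h /=; first by move=> ->; rewrite gact1.
case=> g Hg [[q c] /= qk ->] kp; rewrite gactM IHk ?(ltnW kp) //.
case: c; rewrite ?coset_rep_neg; last by rewrite coset_rep_pos gact_descent_fix //; lia.
rewrite gactM gact_descent_fix; last lia.
by rewrite gact_fixV // gact_descent_fix //; lia.
Qed.

(** * Parabolic subgroups of the cube group *)

(** The stabilizer of the k-face of the base flag is generated by the
reflections of index other than k, which are those that preserve this set. *)
Definition face (k : nat) (x : nat * bool) : bool := ~~ x.2 && (k <= x.1)%N.

Definition preserves (k : nat) (g : CG) : Prop := forall x, face k (gact g x) = face k x.

Lemma preserves_subgroup k : is_subgroup (preserves k).
Proof.
split=> [|g h gk hk] x; first by rewrite gact1.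
by rewrite gactM -hk gactVK gk.
Qed.

Lemma preserves_gen k (i : 'I_n) : i != k :> nat -> preserves k (cube_gen n i).
Proof.
move=> ik [p b]; rewrite gact_gen /face; case: (nat_of_ord i) ik => [|j] /= jk.
  by case: eqP => [->|_]; rewrite ?addbF //= leqn0 eq_sym (negPf jk) !andbF.
congr (_ && _); rewrite /adj_swap; do 2?case: eqP; lia.
Qed.

Lemma generated_descent (A : set CG) a l :
  (forall j, (a <= j < a + l)%N -> generated A (ctau j)) -> generated A (descent a l).
Proof.
elim: l => [|l IHl] Aj; first exact: generated1.
by apply: generatedM; [apply: Aj|apply: IHl => j aj; apply: Aj]; lia.
Qed.

(** Induction along the normal form: the last factor moves the last coordinate
vector, which lies in all faces, and its image shows which generators can
occur. *)
Lemma parabolic_normal_form (I : set 'I_n) m g : (m <= n)%N -> normal_form m g ->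
  (forall k : 'I_n, (k < m)%N -> ~ I k -> preserves k g) ->
  generated (cube_gen n @` I) g.
Proof.
elim: m g => [|m IHm] g mn /=; first by move=> -> _; exact: generated1.
case=> h Hh [y ym ->] gI.
have rep_y : gact (h * coset_rep m y) (m, false) = y.
  by rewrite gactM (gact_normal_form_fix _ Hh) // gact_coset_rep.
have tI j : (j <= m)%N -> ~~ face j y -> generated (cube_gen n @` I) (ctau j).
  move=> jm yj; have jn : (j < n)%N by lia.
  rewrite -[j]/(val (Ordinal jn)) ctauE; apply: mem_generated; exists (Ordinal jn) => //.
  apply: contrapT => /gI /(_ (m, false)); rewrite rep_y (negPf yj) /face /= jm.
  by move/(_ jm).
have repI : generated (cube_gen n @` I) (coset_rep m y).
  case: (y) ym tI => p [] /= pm tI; rewrite ?coset_rep_neg ?coset_rep_pos.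
    apply: generatedM; [|apply: generatedV]; apply: generated_descent => j jm;
      by apply: tI => //; lia.
  by apply: generated_descent => j jm; apply: tI; rewrite /face /=; lia.
apply: generatedM (repI); apply: IHm => //; first lia.
move=> k km kI; have [_ kV] := preserves_subgroup k.
rewrite -[h](mulgK (coset_rep m y)); apply: kV; first by apply: gI => //; lia.
apply: generated_sub (preserves_subgroup k) _ _ repI => _ [i Ii <-].
by apply: preserves_gen; apply: contra_notN kI => /eqP/val_inj <-.
Qed.

(** The right-hand side turns intersections of subgroups into conjunctions. It
also contains the faithfulness of the action, as the case where I is empty. *)
Lemma parabolicP (I : set 'I_n) g :
  generated (cube_gen n @` I) g <-> forall k : 'I_n, ~ I k -> preserves k g.
Proof.
split=> [Ig k kI|gI]; last first.
  by apply: parabolic_normal_form (cube_normal_form g) _ => // k _; exact: gI.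
apply: generated_sub (preserves_subgroup k) _ _ Ig => _ [i Ii <-].
by apply: preserves_gen; apply: contra_notN kI => /eqP/val_inj <-.
Qed.

Lemma gact_inj g h : gact g =1 gact h -> g = h.
Proof.
move=> gh; apply: divg1_eq.
have: generated (cube_gen n @` set0) (g * h^-1).
  by apply/parabolicP => k _ x; rewrite gactM gh gactK.
by apply: (generated_ind (P := fun x => x = 1)) => // [_ [i []]|x _ _ [i []]].
Qed.

Lemma gact_out g p b : (n <= p)%N -> gact g (p, b) = (p, b).
Proof. exact/gact_normal_form_fix/cube_normal_form. Qed.

Lemma gact_in g p b : (p < n)%N -> ((gact g (p, b)).1 < n)%N.
Proof.
move=> pn; rewrite ltnNge; apply: contraL pn => gp; rewrite -leqNgt.
have := gact_out g (gact g (p, b)).2 gp; rewrite -surjective_pairing.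
by move/(congr1 (gact g^-1)); rewrite !gactK => Dp; rewrite Dp in gp.
Qed.

(** * The order of the cube group *)

(** The positions of the coset representatives in a normal form. *)
Fixpoint cube_code (k : nat) : finType :=
  if k is k'.+1 then (cube_code k' * ('I_k * bool))%type else unit.

Fixpoint cube_decode (k : nat) : cube_code k -> CG :=
  match k with
  | 0 => fun=> 1
  | k'.+1 => fun c => cube_decode c.1 * coset_rep k' (val c.2.1, c.2.2)
  end.

Lemma card_cube_code k : #|{: cube_code k}| = (2 ^ k * k`!)%N.
Proof.
elim: k => [|k IHk]; first by rewrite card_unit.
by rewrite !card_prod IHk card_ord card_bool factS expnS; clear n2; lia.
Qed.

Lemma cube_decode_normal k (c : cube_code k) : normal_form k (cube_decode c).
Proof.
elim: k c => //= k IHk c; exists (cube_decode c.1) => //.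
by exists (val c.2.1, c.2.2) => //=.
Qed.

(** The last coset representative is known from the image of the last coordinate
vector, which the other factors fix. *)
Lemma cube_decode_inj k : (k <= n)%N -> injective (@cube_decode k).
Proof.
elim: k => [|k IHk] kn; first by case=> -[].
case=> [c [p b]] [d [q e]] /= cd.
have act_k (c0 : cube_code k) (p0 : 'I_k.+1) (b0 : bool) :
    gact (cube_decode c0 * coset_rep k (val p0, b0)) (k, false) = (val p0, b0).
  rewrite gactM (gact_normal_form_fix _ (cube_decode_normal c0)) //.
  by rewrite gact_coset_rep //= -ltnS.
have := act_k c p b; rewrite cd act_k => -[/val_inj Dq De].
by move: cd; rewrite Dq De => /mulIg/(IHk (ltnW kn)) ->.
Qed.

Lemma cube_decode_surj k g : normal_form k g -> exists c : cube_code k, cube_decode c = g.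
Proof.
elim: k g => [|k IHk] g /=; first by move=> ->; exists tt.
case=> h /IHk[c <-] [[p b] /= pk ->].
by exists (c, (Ordinal pk, b)).
Qed.


Lemma cube_decode_bij : bijective (@cube_decode n).
Proof.
apply: inj_surj_bijective => [|g]; first exact: cube_decode_inj.
exact/cube_decode_surj/cube_normal_form.
Qed.

(** * The cube group is a string C-group *)

Lemma cube_gen_neq1 i : cube_gen n i != 1.
Proof.
apply/eqP => /(congr1 (gact^~ (i : nat, false))); rewrite gact1 gact_gen.
case: (nat_of_ord i) => [|k] //= [].
by rewrite /adj_swap gtn_eqF // eqxx; lia.
Qed.

Lemma cube_intersection (I J : set 'I_n) :
  generated (cube_gen n @` I) `&` generated (cube_gen n @` J) =
  generated (cube_gen n @` (I `&` J)).
Proof.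
apply/seteqP; split=> g; last first.
  by move=> gIJ; split; apply: generated_mono gIJ; apply: image_subset => i [].
case=> /parabolicP gI /parabolicP gJ; apply/parabolicP => k.
by move/not_andP=> [/gI|/gJ].
Qed.

Lemma cube_string_C_group : string_C_group (cube_gen n).
Proof.
split=> [|i||i j ij].
- exact: generated_pgen.
- by rewrite expg2 cube_gen2 cube_gen_neq1.
- exact: cube_intersection.
- by have := cube_rel i j; rewrite string_matrix_far.
Qed.

(** * The Coxeter element and the central symmetry *)

Definition cube_beta : CG := \prod_(i < n) cube_gen n i.

Lemma cube_betaE : cube_beta = ascent 0 n.
Proof.
rewrite /cube_beta; under eq_bigr do rewrite -ctauE.
have E m : \prod_(i < m) ctau i = ascent 0 m; last exact: E.
elim: m => [|m IHm]; first by rewrite big_ord0 ascent0.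
by rewrite big_ord_recr ascentS ?IHm //; exact: ctau2.
Qed.

(** A partial product of the Coxeter element rotates the first m coordinate
vectors and changes one sign. *)
Lemma gact_ascent0 m p b : (m <= n)%N -> gact (ascent 0 m) (p, b) =
  if (m <= p)%N then (p, b) else if p is p'.+1 then (p', b) else (m.-1, ~~ b).
Proof.
elim: m => [|m IHm] mn; first by rewrite ascent0 gact1.
rewrite ascentS; last exact: ctau2.
rewrite gactM IHm ?(ltnW mn) // add0n.
case: (leqP m p) => [mp|pm].
  have [pm|pm] := ltnP m p; first by rewrite gact_ctau_fix ?pm.
  have -> : p = m by lia.
  rewrite gact_ctau //; case: m {IHm mp pm} mn => [|m] mn /=; first by rewrite addbT.
  by rewrite /adj_swap gtn_eqF // eqxx.
rewrite ltnNge (ltnW pm) /=; case: p {IHm} pm => [|p] pm; last first.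
  by rewrite gact_ctau_fix //; lia.
case: m mn pm => // m mn _; rewrite gact_ctau //=.
by rewrite /adj_swap eqxx.
Qed.

Lemma gact_beta p b : (p < n)%N ->
  gact cube_beta (p, b) = if p is p'.+1 then (p', b) else (n.-1, ~~ b).
Proof. by move=> pn; rewrite cube_betaE gact_ascent0 // leqNgt pn. Qed.

Lemma gact_betaX i p b : (i <= n)%N -> (p < n)%N -> gact (cube_beta ^+ i) (p, b) =
  if (i <= p)%N then ((p - i)%N, b) else ((p + n - i)%N, ~~ b).
Proof.
move=> + pn; elim: i => [|i IHi] lein; first by rewrite gact1 subn0.
rewrite expgSr gactM IHi ?(ltnW lein) //; case: (leqP i p) => [ip|pi].
  rewrite gact_beta; last lia.
  have [ip1|pi1] := ltnP i p; first by rewrite (_ : p - i = (p - i.+1).+1)%N; last lia.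
  rewrite (_ : p - i = 0)%N; last lia.
  by congr (_, _); lia.
rewrite leqNgt ltnS (ltnW pi) /= gact_beta; last lia.
by rewrite (_ : p + n - i = (p + n - i.+1).+1)%N; last lia.
Qed.

Notation alpha := (cube_center n).

Lemma gact_center p b : (p < n)%N -> gact alpha (p, b) = (p, ~~ b).
Proof.
by move=> pn; rewrite /cube_center -/cube_beta gact_betaX // leqNgt pn addnK.
Qed.

Lemma cube_center2 : alpha ^+ 2 = 1.
Proof.
apply: gact_inj => -[p b]; rewrite expg2 gactM gact1.
have [pn|np] := ltnP p n; first by rewrite !gact_center // negbK.
by rewrite !gact_out.
Qed.

Lemma cube_center_central g : commute alpha g.
Proof.
apply: gact_inj => -[p b]; rewrite !gactM.
have [pn|np] := ltnP p n; last by rewrite !gact_out.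
rewrite gact_center // gactN; have := @gact_in g p b pn.
by case: (gact g (p, b)) => q c /= qn; rewrite gact_center.
Qed.

(** * Vertices as sign vectors *)

Notation stab := (vertex_stab (cube_gen n)).
Notation F0 := (base_vertex (cube_gen n)).

Lemma stabP g : stab g <-> forall x, (gact g x).2 = x.2.
Proof.
split=> [/parabolicP gS x|gS].
  have n0 : (0 < n)%N by exact: ltnW.
  have /(_ x) : preserves 0 g by apply: (gS (Ordinal n0)).
  rewrite /face !leq0n !andbT.
  by move/negb_inj.
apply/parabolicP => k /negP; rewrite -eqn0Ngt => /eqP-> x.
by rewrite /face gS !leq0n.
Qed.

(** The signs of the vertex to which g moves the positive vertex. *)
Definition signs (g : CG) (p : nat) : bool := (gact g^-1 (p, false)).2.

Lemma signs_stab g h : stab (g * h^-1) <-> {in gtn n, signs g =1 signs h}.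
Proof.
split=> [/stabP gh p _|gh].
  by have := gh (gact g^-1 (p, false)); rewrite gactM gactVK.
apply/stabP => x; rewrite gactM -[x in RHS](gactK g).
case: (gact g x) => q c; rewrite !(gact_signE _ q c).
have [qn|nq] := ltnP q n; first by rewrite -[(gact _ _).2]/(signs h q) -gh.
by rewrite !gact_out.
Qed.

Lemma signs1 p : signs 1 p = false.
Proof. by rewrite /signs invg1 gact1. Qed.

Lemma signsM g h p : signs (g * h) p = (gact g^-1 (gact h^-1 (p, false))).2.
Proof. by rewrite /signs invgM gactM. Qed.

Lemma signs_swap g i p : (i.+1 < n)%N -> signs (g * ctau i.+1) p = signs g (adj_swap i p).
Proof. by move=> lti; rewrite signsM (tV ctau2) gact_ctau. Qed.

Lemma signs_center g p : (p < n)%N -> signs (g * alpha) p = ~~ signs g p.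
Proof.
move=> pn; rewrite signsM (involV cube_center2) gact_center //.
by rewrite gact_signE addTb.
Qed.

Lemma signs_betaX i p : (i <= n)%N -> (p < n)%N ->
  signs (cube_beta ^+ i) p = (n - i <= p)%N.
Proof.
move=> lein pn; rewrite /signs.
have [np|pn'] := leqP (n - i)%N p; last first.
  have -> : (p, false) = gact (cube_beta ^+ i) ((p + i)%N, false).
    by rewrite gact_betaX ?leq_addl ?addnK //; lia.
  by rewrite gactK.
have -> : (p, false) = gact (cube_beta ^+ i) ((p + i - n)%N, true).
  rewrite gact_betaX //; last lia.
  rewrite leqNgt (_ : _ < _)%N /=; last lia.
  by congr (_, _); lia.
by rewrite gactK.
Qed.

(** Up to the vertex stabilizer, a vertex is determined by its number of
negative signs: adjacent swaps sort the signs. *)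
Lemma double_coset_beta g : exists i a b,
  [/\ (i <= n)%N, stab a, stab b & g = a * cube_beta ^+ i * b].
Proof.
(* The weight of a negative sign decreases as the sign moves to the right, which
   is where the powers of the Coxeter element have theirs. *)
pose mu h := (\sum_(p < n) signs h p * (n - p))%N.
move: {2}(mu g).+1 (ltnSn (mu g)) => m; elim: m g => // m IHm g.
case: (pselect (exists2 p, (p.+1 < n)%N & signs g p && ~~ signs g p.+1)); last first.
  (* No negative sign precedes a positive one: q is the first negative place. *)
  move=> sorted _; pose q := find (signs g) (iota 0 n).
  have qn : (q <= n)%N by have := find_size (signs g) (iota 0 n); rewrite size_iota.
  exists (n - q)%N, (g * (cube_beta ^+ (n - q))^-1), 1; split; first exact: leq_subr.
  - apply/signs_stab => p pn; rewrite signs_betaX ?leq_subr // subKn //.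
    have [qp|pq] := leqP q p; last first.
      have := before_find 0%N (pq : (p < find (signs g) (iota 0 n))%N).
      by rewrite nth_iota.
    rewrite -(subnKC qp) in pn *; elim: (p - q)%N pn => [|k IHk] kn.
      rewrite addn0; have /(nth_find 0%N) : has (signs g) (iota 0 n).
        by rewrite has_find size_iota -/q; move: kn; rewrite addn0.
      by rewrite nth_iota -/q //; move: kn; rewrite addn0.
    rewrite addnS in kn *; case E: (signs g _) => //; case: sorted.
    by exists (q + k)%N; rewrite // E IHk //; exact: ltnW.
  - exact: generated1.
  - by rewrite mulg1 mulgVK.
case=> p pn /andP[gp gp1] mu_g.
have [|i [a [b [lein Sa Sb Dg]]]] := IHm (g * ctau p.+1).
  suff: (mu (g * ctau p.+1)%g < mu g)%N by lia.
  rewrite /mu.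
  pose P0 := Ordinal (ltnW pn); pose P1 := Ordinal pn.
  have P01 : P1 != P0 by rewrite -val_eqE /= gtn_eqF.
  rewrite (bigD1 P0) //= (bigD1 P1) //= [ltnRHS](bigD1 P0) //= [in ltnRHS](bigD1 P1) //=.
  rewrite !signs_swap // gp (negPf gp1) /adj_swap eqxx gtn_eqF // eqxx gp (negPf gp1).
  rewrite mul0n add0n mul1n mul0n add0n mul1n.
  under eq_bigr => j /andP[j0 j1].
    rewrite signs_swap // /adj_swap (negPf (_ : (j : nat) != p)) //.
    rewrite (negPf (_ : (j : nat) != p.+1)) //.
    over.
  by rewrite ltn_add2r; lia.
exists i, a, (b * ctau p.+1); split=> //.
  apply: generatedM => //; rewrite -[p.+1]/(val (Ordinal pn)) ctauE.
  by apply: mem_generated; exists (Ordinal pn).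
by rewrite mulgA -Dg mulgtt //; exact: ctau2.
Qed.

Lemma vtrans_base_eq g h : vtrans g F0 = vtrans h F0 <-> stab (g * h^-1).
Proof.
have valE k : sval (vtrans k F0) = rcos (cube_gen n) k.
  rewrite /= /rcos image_comp; apply: eq_imagel => x _ /=; by rewrite mulg1.
split=> [/(congr1 sval)|Sgh].
  rewrite !valE => gh; have: rcos (cube_gen n) g g.
    by exists 1; [exact: generated1|rewrite mul1g].
  by rewrite gh => -[x Sx <-]; rewrite mulgK.
apply: vertex_inj; rewrite !valE; apply/seteqP; split=> _ [x Sx <-].
  by exists (x * (g * h^-1)); [exact: generatedM|rewrite mulgA mulgVK].
exists (x * (g * h^-1)^-1); first by apply: generatedM => //; exact: generatedV.
by rewrite invgM invgK -!mulgA mulVg mulg1.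
Qed.

Lemma vertexP F : exists g, F = vtrans g F0.
Proof.
case: F => A [g DA]; exists g; apply: vertex_inj.
rewrite /= DA /rcos image_comp; apply: eq_imagel => x _ /=; by rewrite mulg1.
Qed.

Lemma stab_fix g : stab g -> vtrans g F0 = F0.
Proof. by move=> Sg; rewrite -[RHS]vtrans1; apply/vtrans_base_eq; rewrite invg1 mulg1. Qed.

Lemma vtrans_signs g h : vtrans g F0 = vtrans h F0 <-> {in gtn n, signs g =1 signs h}.
Proof. by rewrite vtrans_base_eq; exact: signs_stab. Qed.

Lemma cube_centrally_symmetric : centrally_symmetric_polytope (cube_gen n) alpha.
Proof.
have n0 : (0 < n)%N by exact: ltnW.
split=> [|||//|F].
- exact: cube_string_C_group.
- by apply/eqP => /(congr1 (gact^~ (0%N, false))); rewrite gact_center // gact1.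
- exact: cube_center2.
- exact: cube_center_central.
- have [g ->] := vertexP F; rewrite vtransM => /vtrans_signs/(_ 0%N n0).
  by rewrite signs_center // => /esym; case: (signs g 0).
Qed.

(** * Antipodal pairs of vertices *)

Definition pair_index : finType := {ffun 'I_n.-1 -> bool}.

(** The sign of the first coordinate tells the two vertices of an antipodal pair
apart; the pair is given by the other signs relative to the first. *)
Definition vertex_code (g : CG) : pair_index * bool :=
  ([ffun i : 'I_n.-1 => signs g i.+1 (+) signs g 0], signs g 0).

Lemma vertex_codeP g h : vtrans g F0 = vtrans h F0 <-> vertex_code g = vertex_code h.
Proof.
have n0 : (0 < n)%N by exact: ltnW.
rewrite vtrans_signs; split=> [gh|].
  rewrite /vertex_code -gh //; congr (_, _); apply/ffunP => i; rewrite !ffunE gh //.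
  by rewrite inE; have := ltn_ord i; lia.
case=> /ffunP gh gh0 [|p] //; rewrite inE => pn; have pn' : (p < n.-1)%N by lia.
by have := gh (Ordinal pn'); rewrite !ffunE gh0 => /addIb.
Qed.

Lemma vertex_code_center g : vertex_code (g * alpha) = ((vertex_code g).1, ~~ (vertex_code g).2).
Proof.
have n0 : (0 < n)%N by exact: ltnW.
rewrite /vertex_code signs_center //; congr (_, _); apply/ffunP => i.
rewrite !ffunE signs_center; last by have := ltn_ord i; lia.
by rewrite addNb addbN negbK.
Qed.

(** The reflection in a coordinate hyperplane changes a single sign, so that the
signs can be adjusted one after the other. *)
Lemma signs_surj (f : nat -> bool) : exists g, {in gtn n, signs g =1 f}.
Proof.
suff H k : (k <= n)%N -> exists g, {in gtn n, forall p, signs g p = f p && (p < k)%N}.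
  have [g gf] := H n (leqnn n).
  by exists g => p pn; rewrite gf //; move: pn; rewrite inE => ->; rewrite andbT.
elim: k => [|k IHk] kn.
  by exists 1 => p _; rewrite signs1 andbF.
have [g gf] := IHk (ltnW kn).
(* The conjugate of the reflection in the first coordinate hyperplane that
   fixes all coordinate vectors but the one of index k. *)
pose r := descent 1 k * ctau 0 * (descent 1 k)^-1.
have r2 : r * r = 1.
  by rewrite /r !mulgA mulgVK (mulgtt ctau2) mulgV.
have n0 : (0 < n)%N by exact: ltnW.
have actr p b : (p < n)%N -> gact r (p, b) = (p, b (+) (p == k)).
  move=> pn; rewrite !gactM gact_ctau //.
  have := gactK (descent 1 k) (p, b); case: (gact (descent 1 k) (p, b)) => q c /=.
  case: q => [|q] Dq; last first.
    rewrite addbF Dq; case: eqP => [Dp|_]; last by rewrite addbF.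
    move: Dq; rewrite Dp => /(congr1 (gact (descent 1 k))); rewrite gactVK.
    by rewrite -{2}[k]add0n gact_descent.
  move: Dq; rewrite -/(ascent 1 k) !gact_ascent // => -[<- <-].
  by rewrite !eqxx ?addbT.
have [fk|fk] := boolP (f k); last first.
  exists g => p pn; rewrite gf // ltnS [in RHS]leq_eqVlt.
  by case: eqP => [->|_] //=; rewrite (negPf fk) ltnn.
exists (g * r) => p pn; rewrite signsM (involV r2) actr // gact_signE addFb.
rewrite -[(gact _ _).2]/(signs g p) gf // ltnS [in RHS]leq_eqVlt.
by case: eqP => [->|_]; rewrite ?fk ?ltnn // addFb.
Qed.

Lemma vertex_code_surj x : exists g, vertex_code g = x.
Proof.
have n0 : (0 < n)%N by exact: ltnW.
case: x => f b; pose fn p := if insub p is Some i then f i else false.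
have [g gf] := signs_surj (fun p => if p is p'.+1 then fn p' (+) b else b).
exists g; rewrite /vertex_code (gf 0%N) //; congr (_, _); apply/ffunP => i.
rewrite ffunE gf; last by rewrite inE; have := ltn_ord i; lia.
by rewrite /fn valK -addbA addbb addbF.
Qed.

End CubeGroup.

(** * Dihedral groups and their powers *)

Section DihedralNormalForm.
Variables (G : groupType) (x y : G) (s : nat).
Hypotheses (x2 : x * x = 1) (y2 : y * y = 1) (xys : (x * y) ^+ s = 1).

Definition dihedral_elt (c : 'I_s * bool) : G := (x * y) ^+ c.1 * x ^+ c.2.

Lemma expg_mods i : (x * y) ^+ (i %% s) = (x * y) ^+ i.
Proof.
by rewrite [in RHS](divn_eq i s) expgnDr [(_ * s)%N]mulnC expgnA xys expg1n mul1g.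
Qed.

Lemma dihedral_eltMx c : exists c', dihedral_elt c * x = dihedral_elt c'.
Proof.
case: c => i []; [exists (i, false)|exists (i, true)];
  by rewrite /dihedral_elt /= ?mulg1 // -mulgA x2 mulg1.
Qed.

Lemma dihedral_eltMy c : exists c', dihedral_elt c * y = dihedral_elt c'.
Proof.
case: c => i b; have s0 : (0 < s)%N by case: (s) i => // -[].
case: b; [exists (Ordinal (ltn_pmod i.+1 s0), false)|
          exists (Ordinal (ltn_pmod (i + s.-1) s0), true)];
  rewrite /dihedral_elt /= expg_mods ?expg0 ?expg1 ?mulg1; first by rewrite expgSr mulgA.
rewrite expgnDr -mulgA; congr (_ * _); apply: (mulgI (x * y)).
by rewrite mulgA -expgS prednK // xys mul1g -mulgA y2 mulg1.
Qed.

End DihedralNormalForm.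

Lemma dihedral_elt_morph (G H : groupType) (f : G -> H) x y s c :
  {morph f : u v / u * v} -> f (@dihedral_elt G x y s c) = dihedral_elt (f x) (f y) c.
Proof. by move=> fM; rewrite /dihedral_elt fM !(gmorphX fM) fM. Qed.

(** The products of this form are permuted by right multiplication by x and y,
hence exhaust the group, and there are no more of them than elements. *)
Lemma dihedral_generators s : (1 < s)%N ->
  exists x y : 'D_(2 * s)%N,
    [/\ x * x = 1, y * y = 1, (x * y) ^+ s = 1 & bijective (@dihedral_elt _ x y s)].
Proof.
move=> s1; rewrite mul2n; have: 'D_(s.*2) \homg 'D_(s.*2) by exact: homg_refl.
rewrite Grp'_dihedral // => /existsP[[x y] /= /eqP[xy_gen x2 y2 xys]].
rewrite -[x ^+ 2]/(x * x) in x2; rewrite -[y ^+ 2]/(y * y) in y2.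
exists x, y; split=> //.
have s0 : (0 < s)%N by exact: ltnW.
have surj d : exists c : 'I_s * bool, dihedral_elt x y c = d :> 'D_(s.*2).
  pose A : set 'D_(s.*2) := [set x; y].
  pose B := [set e : 'D_(s.*2) | `[< generated A e >]]%SET.
  have gB : group_set B.
    apply/group_setP; split=> [|u v]; rewrite !inE.
      exact: generated1.
    exact: generatedM.
  have Bd : generated A d.
    have : d \in Group gB; last by rewrite !inE.
    have : d \in [set: 'D_(s.*2)]%SET by rewrite inE.
    rewrite -xy_gen; apply/fintype.subsetP; rewrite join_subG !cycle_subG /= !inE.
    by apply/andP; split; apply/asboolP; apply: mem_generated; [left|right].
  apply: (generated_ind (P := fun d => exists c, dihedral_elt x y c = d)) Bd.
  - by move=> a [] ->.
  - by exists (Ordinal s0, false); rewrite /dihedral_elt /= mulg1.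
  - move=> _ a [c <-] [] ->; [have [c' ->] := dihedral_eltMx y x2 c|
      have [c' ->] := dihedral_eltMy y2 xys c]; by exists c'.
pose g d := sval (cid (surj d)); have gK d : dihedral_elt x y (g d) = d.
  exact: svalP (cid (surj d)).
apply: (bij_can_bij _ gK); apply: inj_card_bij; first exact: can_inj gK.
by rewrite card_prod card_ord card_bool -cardsT card_dihedral // muln2.
Qed.

(** The new factor z moves to the left through the factors that follow the one of
index q. *)
Lemma prod_mul_at (G : groupType) (I : eqType) (r : seq I) (F : I -> G) (q : I) z :
  (forall i, i != q -> commute z (F i)) -> uniq r -> q \in r ->
  (\prod_(i <- r) F i) * z = \prod_(i <- r) (if i == q then F i * z else F i).
Proof.
move=> zF; elim: r => // i r IHr /= /andP[ir ur]; rewrite inE !big_cons.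
rewrite eq_sym; have [Dq|iq] := eqVneq i q => [_|/= qr]; last by rewrite -mulgA IHr.
have zP : commute z (\prod_(j <- r) F j).
  rewrite big_seq; apply: commute_prod => j jr; apply: zF; apply: contraNneq ir.
  by rewrite -Dq => <-.
rewrite -!mulgA -zP; congr (_ * (_ * _)); rewrite [LHS]big_seq [RHS]big_seq.
by apply: eq_bigr => j jr; case: eqP => // Dj; rewrite Dq -Dj jr in ir.
Qed.

Section DihedralPower.
Variables (V : choiceType) (M : V -> V -> nat) (N s : nat).
Variables (code : V -> 'I_N * bool) (vert : 'I_N * bool -> V).
Hypotheses (codeK : cancel code vert) (vertK : cancel vert code).
Hypothesis s1 : (1 < s)%N.
Hypothesis ME : forall u v, M u v =
  (if (code u).1 == (code v).1 then if (code u).2 == (code v).2 then 1 else s else 2)%N.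

Local Notation W := (pres (coxeter_relators M)).
Local Notation sig := (pgen (coxeter_relators M)).

Lemma sig2 v : sig v * sig v = 1.
Proof. by have := @coxeter_rel _ M _ v v (@subset_refl _ _); rewrite ME !eqxx. Qed.

Lemma sig_commute u v : (code u).1 != (code v).1 -> commute (sig u) (sig v).
Proof.
move=> uv; apply: invol_commute; rewrite ?sig2 //.
by have := @coxeter_rel _ M _ u v (@subset_refl _ _); rewrite ME (negPf uv).
Qed.

Lemma sig_pair q : (sig (vert (q, false)) * sig (vert (q, true))) ^+ s = 1.
Proof.
have := @coxeter_rel _ M _ (vert (q, false)) (vert (q, true)) (@subset_refl _ _).
by rewrite ME !vertK eqxx.
Qed.

Definition power_elt (c : {ffun 'I_N -> 'I_s * bool}) : W :=
  \prod_(q < N) dihedral_elt (sig (vert (q, false))) (sig (vert (q, true))) (c q).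

(** A generator commutes with the factors of the other pairs and is absorbed by
the factor of its own pair. *)
Lemma power_elt_surj w : exists c, power_elt c = w.
Proof.
apply: (invol_pres_ind (P := fun w => exists c, power_elt c = w) sig2) => [|_ v [c <-]].
  have s0 : (0 < s)%N by exact: ltnW.
  exists [ffun=> (Ordinal s0, false)]; apply: big1 => q _.
  by rewrite ffunE /dihedral_elt /= mulg1.
rewrite -[v]codeK; case: (code v) => q b {v}.
pose D q := @dihedral_elt W (sig (vert (q, false))) (sig (vert (q, true))) s.
have [c' Dc'] : exists c', D q (c q) * sig (vert (q, b)) = D q c'.
  case: b; first exact: dihedral_eltMy (sig2 _) (sig_pair q) _.
  exact: dihedral_eltMx (sig2 _) _.
exists [ffun i => if i == q then c' else c i].
rewrite /power_elt (prod_mul_at (q := q)) ?index_enum_uniq ?mem_index_enum //.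
  by apply: eq_bigr => i _; rewrite ffunE; case: eqP => [->|].
move=> i iq; have cz b' : commute (sig (vert (q, b))) (sig (vert (i, b'))).
  by apply: sig_commute; rewrite !vertK eq_sym.
by apply: commuteM; apply: commuteX => //; apply: commuteM.
Qed.

Section Coordinates.
Variables (H : groupType) (x y : H).
Hypotheses (x2 : x * x = 1) (y2 : y * y = 1) (xys : (x * y) ^+ s = 1).

(** Every pair of generators is sent to the pair (x, y) in its own factor. *)
Definition coord_gen (v : V) : {ffun 'I_N -> H} :=
  [ffun q => if q == (code v).1 then if (code v).2 then y else x else 1].

Lemma ffun_eval_morph (q : 'I_N) : {morph (fun f : {ffun 'I_N -> H} => f q) : u v / u * v}.
Proof. by move=> u v; rewrite ffunE. Qed.

Lemma coord_gen_rel u v : (coord_gen u * coord_gen v) ^+ M u v = 1.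
Proof.
apply/ffunP => q; rewrite (gmorphX (ffun_eval_morph q)) !ffunE ME.
case: (code u) => p b; case: (code v) => p' b' /=.
have yxs : (y * x) ^+ s = 1.
  by apply: invg_inj; rewrite invg1 -expVgn invgM (involV x2) (involV y2).
have [<-|pp'] := eqVneq p p'; case: eqP => [Dq|_].
- by case: b; case: b' => //=; rewrite ?expg1.
- by rewrite mulg1 expg1n.
- by rewrite Dq (negPf pp') mulg1; case: b.
- by rewrite mul1g; case: eqP; rewrite ?expg1n //; case: b'.
Qed.

Definition coordinates : W -> {ffun 'I_N -> H} := plift (coxeter_weval coord_gen_rel).

HB.instance Definition _ := Multiplicative.on coordinates.

Lemma coordinatesM : {morph coordinates : u v / u * v}.
Proof. exact: pliftM. Qed.

Lemma coordinates_sig v : coordinates (sig v) = coord_gen v.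
Proof. exact: plift_gen. Qed.

Lemma coordinates_power_elt c q : coordinates (power_elt c) q = dihedral_elt x y (c q).
Proof.
have fM : {morph (fun w => coordinates w q) : u v / u * v}.
  by move=> u v; rewrite coordinatesM ffunE.
rewrite /power_elt (big_morph (fun w => coordinates w q) fM (gmorph1 fM)).
rewrite (eq_bigr (fun i => if i == q then dihedral_elt x y (c i) else 1)) => [|i _].
  by rewrite -big_mkcond big_pred1_eq.
rewrite (dihedral_elt_morph _ _ _ fM) !coordinates_sig !ffunE !vertK /=.
by rewrite eq_sym; case: eqP => // _; rewrite /dihedral_elt mulg1 !expg1n mulg1.
Qed.

(** Both groups have the normal forms indexed by the families of pairs in
'I_s * bool. *)
Lemma coordinates_bij : bijective (@dihedral_elt H x y s) -> bijective coordinates.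
Proof.
move=> xy_bij; apply: inj_surj_bijective => [u v|f].
  have [c <-] := power_elt_surj u; have [d <-] := power_elt_surj v.
  move/ffunP => cd; congr power_elt; apply/ffunP => q.
  by apply: (bij_inj xy_bij); rewrite -!coordinates_power_elt cd.
have [g _ gK] := xy_bij; exists (power_elt [ffun q => g (f q)]).
by apply/ffunP => q; rewrite coordinates_power_elt ffunE gK.
Qed.

End Coordinates.

Lemma dihedral_power :
  exists f : {multiplicative W -> {ffun 'I_N -> 'D_(2 * s)%N}}, bijective f.
Proof.
have [x [y [x2 y2 xys xy_bij]]] := dihedral_generators s1.
by exists (coordinates x2 y2 xys); exact: coordinates_bij.
Qed.

(** The coordinate at the pair of v has these properties. *)
Lemma sig_separated v : exists f : W -> 'D_(2 * s)%N,
  [/\ {morph f : u w / u * w}, f (sig v) != 1 &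
      forall u, (code u).1 != (code v).1 -> f (sig u) = 1].
Proof.
have [x [y [x2 y2 xys xy_bij]]] := dihedral_generators s1.
pose p := (code v).1; exists (fun w => coordinates x2 y2 xys w p); split.
- by move=> u w; rewrite coordinatesM ffunE.
- have s0 : (0 < s)%N by exact: ltnW.
  rewrite coordinates_sig ffunE eqxx; case: (code v).2; apply/eqP => E.
    have: dihedral_elt x y (Ordinal s1, false) = dihedral_elt x y (Ordinal s0, true).
      by rewrite /dihedral_elt E /= !mulg1 mul1g.
    by move/(bij_inj xy_bij).
  have: dihedral_elt x y (Ordinal s0, true) = dihedral_elt x y (Ordinal s0, false).
    by rewrite /dihedral_elt E /= mulg1.
  by move/(bij_inj xy_bij).
- by move=> u uv; rewrite coordinates_sig ffunE eq_sym (negPf uv).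
Qed.

End DihedralPower.

(** * Semidirect products *)

Lemma card_semidirect (G W : groupType) (a : autaction G W) (X Y : finType)
    (f : X -> G) (g : W -> Y) :
  bijective f -> bijective g -> ([set: sdprod_of a] #= `I_(#|X| * #|Y|)%N)%card.
Proof.
case=> f' fK f'K [g' gK g'K]; rewrite -card_prod.
apply: (@card_eq_bijective _ _ (fun x : sdprod_of a => (f' x.1, g x.2))).
by exists (fun x => (f x.1, g' x.2)) => -[x y] /=; rewrite ?f'K ?gK ?fK ?g'K.
Qed.

(** The action, and with it the semidirect product, is transported along an
isomorphism of the normal subgroup. *)
Lemma semidirect_transport (G W D : groupType) (a : autaction G W)
    (f : {multiplicative W -> D}) : bijective f ->
  exists (b : autaction G D) (F : {multiplicative sdprod_of a -> sdprod_of b}), bijective F.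
Proof.
case=> g fK gK; have gM : {morph g : x y / x * y} := can2_gmulfM fK gK.
pose b (x : G) d := f (a x (g d)).
have b1 d : b 1 d = d by rewrite /b aact1 gK.
have bM x y d : b (x * y) d = b y (b x d) by rewrite /b aactM fK.
have bJ x d e : b x (d * e) = b x d * b x e by rewrite /b gM aactJ gmulfM.
exists (AutAction b1 bM bJ).
pose F (x : sdprod_of a) := (x.1, f x.2) : sdprod_of (AutAction b1 bM bJ).
have [F' DF'] : exists F' : {multiplicative _ -> _}, F' = F :> (_ -> _).
  apply: multiplicative_of_morph => -[x u] [y v]; congr (_, _).
  by rewrite /= gmulfM /b fK.
exists F'; rewrite DF'; exists (fun x => (x.1, g x.2)) => -[x u];
  by rewrite /F /= ?fK ?gK.
Qed.

(** * The twisted group over the cube *)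

Section TwistedCube.
Variables n s : nat.
Hypotheses (n2 : (2 <= n)%N) (s2 : (2 <= s)%N).

Notation CG := (cube_group n).
Notation tau := (cube_gen n).
Notation alpha := (cube_center n).
Notation F0 := (base_vertex tau).
Notation V := (vertex tau).
Notation W := (diagram_group tau alpha s).
Notation pairs := ('I_(2 ^ n.-1)%N).

Definition sigma (F : V) : W := pgen _ F.
Definition vt (g : CG) : V := vtrans g F0.

Lemma vtM g h : vtrans h (vt g) = vt (g * h). Proof. exact: vtransM. Qed.
Lemma vt1 : vt 1 = F0. Proof. exact: vtrans1. Qed.

Lemma card_pair_index : #|pair_index n| = (2 ^ n.-1)%N.
Proof. by rewrite card_ffun card_bool card_ord. Qed.

Definition pair_rank (f : pair_index n) : pairs := cast_ord card_pair_index (enum_rank f).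

Lemma pair_rank_bij : bijective pair_rank.
Proof.
exists (fun i => enum_val (cast_ord (esym card_pair_index) i)) => x; rewrite /pair_rank.
  by rewrite cast_ordK enum_rankK.
by rewrite enum_valK cast_ordKV.
Qed.

Definition vrep (F : V) : CG := sval (cid (vertexP F)).

Lemma vrepK F : vt (vrep F) = F.
Proof. exact/esym/(svalP (cid (vertexP F))). Qed.

(** The antipodal pair of a vertex, and its place in the pair. *)
Definition vcode (F : V) : pairs * bool :=
  (pair_rank (vertex_code (vrep F)).1, (vertex_code (vrep F)).2).

Lemma vcodeE g : vcode (vt g) = (pair_rank (vertex_code g).1, (vertex_code g).2).
Proof.
rewrite /vcode; suff -> : vertex_code (vrep (vt g)) = vertex_code g by [].
by apply/(vertex_codeP n2); rewrite -!/(vt _) vrepK.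
Qed.

Lemma vcode_bij : bijective vcode.
Proof.
apply: inj_surj_bijective => [F F'|[q b]].
  rewrite -(vrepK F) -(vrepK F'); move: (vrep F) (vrep F') => g h.
  rewrite !vcodeE => /pair_equal_spec[].
  move=> /(bij_inj pair_rank_bij) gh1 gh2; apply/(vertex_codeP n2).
  by rewrite [LHS]surjective_pairing gh1 gh2 -surjective_pairing.
have [r _ rK] := pair_rank_bij; have [g Dg] := vertex_code_surj n2 (r q, b).
by exists (vt g); rewrite vcodeE Dg /= rK.
Qed.

Lemma vcode_center g : vcode (vt (g * alpha)) = ((vcode (vt g)).1, ~~ (vcode (vt g)).2).
Proof. by rewrite !vcodeE vertex_code_center. Qed.

Lemma diagram_matrixE (F F' : V) : diagram_matrix alpha s F F' =
  (if (vcode F).1 == (vcode F').1 then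
     if (vcode F).2 == (vcode F').2 then 1 else s else 2)%N.
Proof.
rewrite -(vrepK F) -(vrepK F'); move: (vrep F) (vrep F') => g h; rewrite /diagram_matrix.
rewrite vtM -!(inj_eq (bij_inj vcode_bij)) vcode_center.
case: (vcode (vt g)) (vcode (vt h)) => q b [r c]; rewrite !xpair_eqE /=.
rewrite [r == q]eq_sym; case: (q == r) => //=.
by case: b; case: c.
Qed.

Lemma sigma2 F : sigma F * sigma F = 1.
Proof.
apply: (coxeter_invol (M := diagram_matrix alpha s)) => //.
by rewrite diagram_matrixE !eqxx.
Qed.

Lemma sigma_rel g h : (sigma (vt g) * sigma (vt h)) ^+ diagram_matrix alpha s (vt g) (vt h) = 1.
Proof. exact: coxeter_rel. Qed.

Lemma sigma_antipodal g : (sigma (vt g) * sigma (vt (g * alpha))) ^+ s = 1.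
Proof.
have := sigma_rel g (g * alpha); rewrite diagram_matrixE vcode_center eqxx.
by case: (vcode _).2.
Qed.

(** Whether two given signs of a vertex agree is a property of its antipodal
pair, since the central symmetry changes both. *)
Lemma vcode_neq g h p q : (p < n)%N -> (q < n)%N ->
  signs g p (+) signs g q != signs h p (+) signs h q -> (vcode (vt g)).1 != (vcode (vt h)).1.
Proof.
move=> pn qn; apply: contraNneq; rewrite !vcodeE /= => /(bij_inj pair_rank_bij)/ffunP gh.
have gh0 i : (i < n)%N -> signs g i (+) signs g 0 = signs h i (+) signs h 0.
  case: i => [|i] lti; first by rewrite !addbb.
  have lti' : (i < n.-1)%N by lia.
  by have := gh (Ordinal lti'); rewrite !ffunE.
move: (gh0 p pn) (gh0 q qn); do 6!case: (signs _ _); by [].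
Qed.

Lemma sigma_commute g h : (vcode (vt g)).1 != (vcode (vt h)).1 ->
  (sigma (vt g) * sigma (vt h)) ^+ 2 = 1.
Proof. by move=> gh; have := sigma_rel g h; rewrite diagram_matrixE (negPf gh). Qed.

Lemma diagram_group_dihedral :
  exists f : {multiplicative W -> {ffun pairs -> 'D_(2 * s)%N}}, bijective f.
Proof.
have [vert codeK vertK] := vcode_bij.
exact: (dihedral_power codeK vertK s2 diagram_matrixE).
Qed.

Lemma sigma_separated g : exists f : W -> 'D_(2 * s)%N,
  [/\ {morph f : u w / u * w}, f (sigma (vt g)) != 1 &
      forall h, (vcode (vt h)).1 != (vcode (vt g)).1 -> f (sigma (vt h)) = 1].
Proof.
have [f [fM fg fh]] := sig_separated s2 diagram_matrixE (vt g).
by exists f; split=> // h; exact: fh.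
Qed.

Lemma sigma_neq1 g : sigma (vt g) != 1.
Proof.
have [f [fM + _]] := sigma_separated g.
by apply: contraNneq => ->; rewrite (gmorph1 fM).
Qed.

Variable cs : centrally_symmetric_polytope tau alpha.

Notation T := (twist_group cs s).
Notation rho := (twist_gen cs s).

Lemma dact_sigma g h : dact g (sigma (vt h)) = sigma (vt (h * g)).
Proof. by rewrite -(vtM h g) /sigma /pgen (dact_pcls cs). Qed.

Definition tinl (g : CG) : T := (g, 1).
Definition tinr (w : W) : T := (1, w).

Lemma tinlM : {morph tinl : g h / g * h}.
Proof.
move=> g h; congr (_, _); rewrite /= mulg1.
exact: esym (aact_1 (diagram_action cs s) h).
Qed.

Lemma tinrM : {morph tinr : u v / u * v}.
Proof. by move=> u v; congr (_, _); rewrite /= ?mulg1 ?(dact1 cs). Qed.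

Lemma twistE (x : T) : x = tinl x.1 * tinr x.2.
Proof.
case: x => g w; congr (_, _); first by rewrite /= mulg1.
by rewrite /= (dact1 cs) mul1g.
Qed.

Lemma tinrJ w g : tinr w ^ tinl g = tinr (dact g w).
Proof.
rewrite conjgE -(gmorphV tinlM); congr (_, _); rewrite /= ?mul1g ?mulVg //.
by rewrite mulg1 [dact g 1](aact_1 (diagram_action cs s) g) mul1g.
Qed.

Lemma tinr_sigmaJ g h : tinr (sigma (vt g)) ^ tinl h = tinr (sigma (vt (g * h))).
Proof. by rewrite tinrJ dact_sigma. Qed.

Lemma rho0 : rho ord0 = tinr (sigma (vt 1)).
Proof. by rewrite /twist_gen unlift_none vt1. Qed.

Lemma rhoS j : rho (lift ord0 j) = tinl (tau j).
Proof. by rewrite /twist_gen liftK. Qed.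

Lemma rho2 i : rho i * rho i = 1.
Proof.
case: (unliftP ord0 i) => [j|] ->; first by rewrite rhoS -tinlM cube_gen2.
by rewrite rho0 -tinrM sigma2.
Qed.

Lemma rho0_conj g : (rho ord0 * rho ord0 ^ tinl g) = tinr (sigma (vt 1) * sigma (vt g)).
Proof. by rewrite rho0 tinr_sigmaJ mul1g -tinrM. Qed.

Lemma signs_tau0 g p : signs (g * ctau n 0) p = signs g p (+) (p == 0).
Proof.
rewrite signsM // (tV (@ctau2 n)) gact_ctau //=; last lia.
by rewrite gact_signE // addbC.
Qed.

(** This turns the Coxeter relations of the generator of index 0 into relations
between the involutions of two vertices. *)
Lemma invol_mulX2 (G : groupType) (a b : G) : b * b = 1 -> (a * b) ^+ 2 = a * a ^ b.
Proof. by move=> b2; rewrite expg2 conjgE (involV b2) !mulgA. Qed.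

Lemma vcode_base_tau0 : (vcode (vt 1)).1 != (vcode (vt (ctau n 0))).1.
Proof.
apply: (@vcode_neq _ _ 0 1); rewrite ?(ltnW n2) //.
by rewrite -[ctau n 0]mul1g !signs_tau0 !signs1.
Qed.

Lemma rho01_square :
  (rho ord0 * tinl (ctau n 0)) ^+ 2 = tinr (sigma (vt 1) * sigma (vt (ctau n 0))).
Proof. by rewrite invol_mulX2 ?rho0_conj // -tinlM ctau2. Qed.

Lemma vt_gen (i : 'I_n) : (0 < i)%N -> vt (tau i) = vt 1.
Proof. by move=> i0; rewrite vt1; apply: stab_fix; apply: mem_generated; exists i. Qed.

Lemma rho_rel i j : (rho i * rho j) ^+ string_matrix n.+1 [:: 4, 4 & nseq (n - 2) 3] i j = 1.
Proof.
move: i j; apply: string_relations => [i|i j|i j].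
- exact: rho2.
- case: (unliftP ord0 j) => [j' ->|->] //; rewrite lift0 => -[].
  case: (unliftP ord0 i) => [i' ->|->]; rewrite ?lift0 /= => ij.
    rewrite !rhoS -tinlM -(gmorphX tinlM); have := cube_rel i' j'.
    by rewrite string_matrix_next // => ->.
  have Dj' : tau j' = ctau n 0 by rewrite -ctauE ij.
  rewrite rhoS Dj' -[4%N]/(2 * 2)%N expgnA.
  by rewrite rho01_square -(gmorphX tinrM) sigma_commute ?vcode_base_tau0.
- case: (unliftP ord0 j) => [j' ->|->] //; rewrite lift0 ltnS.
  case: (unliftP ord0 i) => [i' ->|->]; rewrite ?lift0 => ij.
    rewrite !rhoS -tinlM -(gmorphX tinlM); have := cube_rel i' j'.
    by rewrite string_matrix_far ?ij // => ->; exact: gmorph1 tinlM.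
  rewrite rhoS invol_mulX2 -?tinlM ?cube_gen2 // rho0_conj.
  by rewrite [vt (tau j')]vt_gen // vt1 sigma2; exact: gmorph1 tinrM.
Qed.

(** * The twisted group is a string C-group *)

Definition base_orbit (I : set 'I_n.+1) : set V :=
  [set F | I ord0 /\ exists2 g, generated (tau @` [set j | I (lift ord0 j)]) g & F = vt g].

(** The parabolic subgroup on the left conjugates the generator of index 0, if
present, to the involutions of the vertices in the orbit of the base vertex. *)
Lemma twist_generated (I : set 'I_n.+1) : generated (rho @` I) =
  [set x : T | generated (tau @` [set j | I (lift ord0 j)]) x.1 /\
               generated (sigma @` base_orbit I) x.2].
Proof.
set K := generated (tau @` _); set B := generated (sigma @` _).
have BJ g w : K g -> B w -> B (dact g w).
  move=> Kg; apply: (@generated_sub _ _ (fun w => B (dact g w))).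
    pose a := diagram_action cs s; split=> [|u v Bu Bv].
      by rewrite [dact g 1](aact_1 a); exact: generated1.
    rewrite [dact _ _](aactJ a) [a g v^-1]aact_V; apply: generatedM => //.
    exact: generatedV.
  move=> _ [F [I0 [h Kh ->]] <-]; rewrite dact_sigma; apply: mem_generated.
  by exists (vt (h * g)) => //; split=> //; exists (h * g) => //; exact: generatedM.
have tinlK g : K g -> generated (rho @` I) (tinl g).
  move/(generated_image tinlM); apply: generated_mono => _ [_ [j Ij <-] <-].
  by exists (lift ord0 j); rewrite ?rhoS.
apply/seteqP; split=> [|x [Kx Bx]].
  apply: generated_sub => [|_ [i Ii <-]].
    split=> [|[g u] [h v] /= [Kg Bu] [Kh Bv]]; first by split; exact: generated1.
    have KhV : K h^-1 by exact: generatedV.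
    split; first exact: generatedM.
    by apply: generatedM; [exact: BJ|apply: generatedV; exact: BJ].
  case: (unliftP ord0 i) Ii => [j ->|->] Ii; rewrite ?rhoS ?rho0; split=> /=.
  - by apply: mem_generated; exists j.
  - exact: generated1.
  - exact: generated1.
  - apply: mem_generated; exists (vt 1) => //; split=> //.
    by exists 1 => //; exact: generated1.
rewrite [x]twistE; apply: generatedM; first exact: tinlK.
have /(generated_image tinrM) := Bx.
apply: generated_sub; first exact: generated_subgroup.
move=> _ [_ [F [I0 [g Kg ->]] <-] <-].
rewrite -[g]mul1g -tinr_sigmaJ -rho0; have := tinlK _ Kg => gI.
rewrite conjgE; apply: generatedM; first exact: generatedV.
by apply: generatedM => //; apply: mem_generated; exists ord0.
Qed.

(** The orbit of the base vertex under a standard parabolic subgroup only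
depends on the longest run of generators, starting with the first, that the
subgroup contains: a generator beyond the first missing one fixes the base
vertex and commutes with the run. *)
Lemma orbit_initial_run (I J : set 'I_n) :
  (forall k : 'I_n, (forall j : 'I_n, (j <= k)%N -> I j) -> J k) ->
  forall g, generated (tau @` I) g ->
  exists2 h, generated (tau @` (I `&` J)) h & vt g = vt h.
Proof.
move=> IJ; pose run := [set k : 'I_n | forall j : 'I_n, (j <= k)%N -> I j].
have runIJ : run `<=` I `&` J by move=> k rk; split; [exact: rk|exact: IJ].
move=> g Ig; suff [h rh gh] : exists2 h, generated (tau @` run) h & vt g = vt h.
  by exists h => //; apply: generated_mono rh; exact: image_subset.
apply: (generated_ind (P := fun g => exists2 h, generated (tau @` run) h & vt g = vt h)) Ig.
- by move=> _ [i _ <-]; exact: cube_gen2.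
- by exists 1 => //; exact: generated1.
move=> {}g _ [h rh gh] [i Ii <-].
have [ri|/existsNP[j /not_implyP[ji nIj]]] := pselect (run i).
  exists (h * tau i); last by rewrite -!vtM gh.
  by apply: generatedM => //; apply: mem_generated; exists i.
have {ji} ji : (j < i)%N.
  by rewrite ltn_neqAle ji andbT; apply: contra_not_neq nIj => /val_inj ->.
exists h => //; rewrite -vtM gh vtM.
have -> : h * tau i = tau i * h.
  apply: (generated_ind (P := fun h => h * tau i = tau i * h)) rh.
  - by move=> _ [k _ <-]; exact: cube_gen2.
  - by rewrite mulg1 mul1g.
  move=> x _ xi [k rk <-]; rewrite [in RHS]mulgA -xi -!mulgA; congr (_ * _).
  have kj : (k < j)%N by rewrite ltnNge; apply/negP => /rk.
  rewrite -!ctauE; apply: ctau_far; lia.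
by rewrite -vtM [vt (tau i)]vt_gen ?vtM ?mul1g //; lia.
Qed.

(** Of two initial runs of generators, one contains the other. *)
Lemma base_orbit_chain (I J : set 'I_n.+1) :
  base_orbit I `<=` base_orbit (I `&` J) \/ base_orbit J `<=` base_orbit (I `&` J).
Proof.
have half (A B : set 'I_n.+1) : B ord0 ->
    (forall k : 'I_n, (forall j : 'I_n, (j <= k)%N -> A (lift ord0 j)) -> B (lift ord0 k)) ->
    base_orbit A `<=` base_orbit (A `&` B).
  move=> B0 AB F [A0 [g Ag ->]]; split=> //.
  by have [h ABh gh] := orbit_initial_run AB Ag; exists h.
have [I0|nI0] := pselect (I ord0); last by left=> F [].
have [J0|nJ0] := pselect (J ord0); last by right=> F [].
pose run k := forall j : 'I_n, (j <= k)%N -> I (lift ord0 j).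
have [IJ|] := pselect (forall k : 'I_n, run k -> J (lift ord0 k)).
  by left; exact: half.
move=> /existsNP[k /not_implyP[rk nJk]]; right; rewrite setIC; apply: half => // m Jm.
by apply: rk; rewrite leqNgt; apply/negP => /ltnW/Jm.
Qed.

Lemma twist_string_C_group : string_C_group rho.
Proof.
split.
- apply/seteqP; split=> // x _; rewrite twist_generated; split.
    have -> : tau @` [set j | setT (lift ord0 j)] = range tau by apply: eq_imagel.
    by rewrite /cube_gen generated_pgen.
  have -> : base_orbit setT = setT.
    apply/seteqP; split=> // F _; split=> //; exists (vrep F); last by rewrite vrepK.
    have -> : tau @` [set j | setT (lift ord0 j)] = range tau by [].
    by rewrite /cube_gen generated_pgen.
  by rewrite /sigma generated_pgen.
- move=> i; split; last exact: rho2.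
  case: (unliftP ord0 i) => [j ->|->]; rewrite ?rhoS ?rho0.
    by apply/eqP => /(congr1 fst) /= /eqP; rewrite (negPf (cube_gen_neq1 n2 j)).
  by apply/eqP => /(congr1 snd) /= /eqP; rewrite (negPf (sigma_neq1 1)).
- move=> I J; rewrite !twist_generated; apply/seteqP; split=> x /=; last first.
    case=> Kx Bx; split; split; first [apply: generated_mono Kx|apply: generated_mono Bx];
      apply: image_subset => z; first [by case=> Iz Jz|case=> -[I0 J0] [g Kg ->]; split=> //];
      by exists g => //; apply: generated_mono Kg; apply: image_subset => j [].
  case=> -[KI BI] [KJ BJ]; split.
    by have : (generated (tau @` [set j | I (lift ord0 j)]) `&`
               generated (tau @` [set j | J (lift ord0 j)])) x.1 by [];
      rewrite (cube_intersection n2).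
  by have [IJ|JI] := base_orbit_chain I J; [apply: generated_mono BI|apply: generated_mono BJ];
    exact: image_subset.
- by move=> i j ij; have := rho_rel i j; rewrite string_matrix_far.
Qed.

Lemma twist_schlafli : schlafli_type rho [:: 4, 4 & nseq (n - 2) 3].
Proof.
split=> [|i j]; first by rewrite /= size_nseq; lia.
case: (unliftP ord0 j) => [j' ->|->] //; rewrite lift0 => -[].
case: (unliftP ord0 i) => [i' ->|->]; rewrite ?lift0 /= => ij; last first.
  have Dj' : tau j' = ctau n 0 by rewrite -ctauE ij.
  rewrite rhoS Dj'; apply: (@has_order_prime_power _ _ 2 1) => //.
    rewrite rho01_square; apply/eqP => /(congr1 snd) /= E.
    have [f [fM /eqP f0 f1]] := sigma_separated 1; case: f0.
    have ft : f (sigma (vt (ctau n 0))) = 1.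
      by apply: f1; rewrite eq_sym; exact: vcode_base_tau0.
    by rewrite -[f _]mulg1 -ft -fM E (gmorph1 fM).
  have := rho_rel ord0 (lift ord0 j'); rewrite rhoS Dj' string_matrix_next ?lift0 ?ij //.
have lti : (i'.+1 < n)%N by rewrite -ij.
have := rho_rel (lift ord0 i') (lift ord0 j'); rewrite !rhoS -tinlM.
rewrite string_matrix_next ?lift0 ?ij //=.
have -> : tau i' * tau j' = ctau n i' * ctau n i'.+1 by rewrite -ij !ctauE.
move=> E; have act1 k x : tinl (ctau n i' * ctau n i'.+1) ^+ k = 1 ->
    gact ((ctau n i' * ctau n i'.+1) ^+ k) x = x.
  by rewrite -(gmorphX tinlM) => /(congr1 fst) /= ->; rewrite gact1.
case Di: (nat_of_ord i') lti {ij} E act1 => [|k] lti E act1.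
  apply: (@has_order_prime_power _ _ 2 1) => //; apply/eqP => /(act1 _ (0%N, false)).
  by rewrite expg2 !(gactM n2) !(gact_ctau n2 _ (ltnW n2), gact_ctau n2 _ n2).
have -> : nth 0%N (4 :: nseq (n - 2) 3) k.+1 = 3.
  by rewrite /= nth_nseq ifT //; lia.
apply: (@has_order_prime_power _ _ 3 0) => //.
  apply/eqP => /(act1 _ (k, false)).
  rewrite expg1 !(gactM n2) !(gact_ctau n2 _ (ltnW lti), gact_ctau n2 _ lti) //=.
  by rewrite /adj_swap !eqxx => -[]; lia.
by move: E; rewrite /= nth_nseq ifT //; lia.
Qed.

(** * Structure and order of the twisted group *)

Lemma twist_semidirect :
  exists (a : autaction CG {ffun pairs -> 'D_(2 * s)%N})
         (f : {multiplicative T -> sdprod_of a}), bijective f.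
Proof. by have [f f_bij] := diagram_group_dihedral; exact: semidirect_transport f_bij. Qed.

Lemma twist_card : ([set: T] #= `I_((2 * s) ^ (2 ^ n.-1) * 2 ^ n * n`!)%N)%card.
Proof.
have [f f_bij] := diagram_group_dihedral.
have := @card_semidirect _ _ (diagram_action cs s) _ _ _ _ (cube_decode_bij n2) f_bij.
rewrite card_cube_code card_ffun card_ord.
have -> : #|{: 'D_(2 * s)%N}| = (2 * s)%N.
  by rewrite -cardsT mul2n card_dihedral.
by rewrite mulnC mulnA.
Qed.

(** * Presentation of the twisted group *)

Local Notation big_relators :=
  (coxeter_relators (string_matrix n.+1 [:: 4, 4 & nseq (n - 2) 3]) `|` extra_relators n s).

Lemma weval_beta (G : groupType) (g : 'I_n.+1 -> G) :
  weval g (w_beta n) = \prod_(j < n) g (lift ord0 j).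
Proof.
have -> : \prod_(j < n) g (lift ord0 j) = \prod_(j <- enum 'I_n) g (lift ord0 j).
  by rewrite [index_enum _]unlock enumT.
rewrite /w_beta; elim: (enum 'I_n) => [|j r IHr]; first by rewrite big_nil weval_nil.
by rewrite big_cons -IHr /= -cat1s weval_cat weval_gen.
Qed.

Lemma weval_twisted_pair (G : groupType) (g : 'I_n.+1 -> G) i :
  weval g (w_rho0 n ++ winv (wpow (w_beta n) i) ++ w_rho0 n ++ wpow (w_beta n) i) =
  g ord0 * g ord0 ^ (weval g (w_beta n) ^+ i).
Proof. by rewrite !weval_cat weval_inv weval_pow !weval_gen conjgE. Qed.

Lemma weval_beta_rho : weval rho (w_beta n) = tinl (cube_beta n).
Proof.
rewrite weval_beta (big_morph tinl tinlM (gmorph1 tinlM)).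
by apply: eq_bigr => j _; rewrite rhoS.
Qed.

Lemma vcode_base_beta i : (0 < i < n)%N ->
  (vcode (vt 1)).1 != (vcode (vt (cube_beta n ^+ i))).1.
Proof.
move=> lti; apply: (@vcode_neq _ _ 0 n.-1); try lia.
have n0 : (0 < n)%N by lia.
by rewrite !(signs1 n2) !(signs_betaX n2) ?ltn_predL ?(ltnW n2) //; lia.
Qed.

Lemma twist_relators r : big_relators r -> weval rho r = 1.
Proof.
case=> [|[[i /= lti <-]|->]]; first exact/coxeter_weval/rho_rel.
  rewrite weval_pow weval_twisted_pair weval_beta_rho -(gmorphX tinlM).
  rewrite rho0_conj -(gmorphX tinrM) sigma_commute ?gmorph1 //; first exact: tinrM.
  by apply: vcode_base_beta; lia.
rewrite weval_pow !weval_cat !weval_gen weval_pow weval_beta_rho -(gmorphX tinlM).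
rewrite -[cube_beta n ^+ n]/alpha; set a := tinl alpha.
have aV : a^-1 = a by apply: involV; rewrite -tinlM -expg2 cube_center2.
rewrite !mulgA -(mulgA (_ * _)) -!mulgA.
have -> : rho ord0 * (a * (rho ord0 * a)) = rho ord0 * rho ord0 ^ a.
  by rewrite conjgE aV.
rewrite rho0_conj -(gmorphX tinrM); have := sigma_antipodal 1; rewrite mul1g => ->.
exact: gmorph1 tinrM.
Qed.

Section Inverse.

Notation P := (pres big_relators).
Notation r := (pgen big_relators).

Lemma r_rel i j : (r i * r j) ^+ string_matrix n.+1 [:: 4, 4 & nseq (n - 2) 3] i j = 1.
Proof. by apply: coxeter_rel; left. Qed.

Lemma r2 i : r i * r i = 1.
Proof. by have := r_rel i i; rewrite string_matrix_diag. Qed.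

Lemma cube_lift_rel (i j : 'I_n) :
  (r (lift ord0 i) * r (lift ord0 j)) ^+ string_matrix n (cube_type n) i j = 1.
Proof. by rewrite -(string_matrix_lift 4); exact: r_rel. Qed.

Definition phi : CG -> P := plift (coxeter_weval cube_lift_rel).

Lemma phiM : {morph phi : g h / g * h}. Proof. exact: pliftM. Qed.

Lemma phi_gen j : phi (tau j) = r (lift ord0 j). Proof. exact: plift_gen. Qed.

(** The vertex stabilizer is generated by the images of the generators that are
not adjacent to the first one in the diagram. *)
Lemma phi_stab g : vertex_stab tau g -> r ord0 ^ phi g = r ord0.
Proof.
apply: (generated_ind (P := fun g => r ord0 ^ phi g = r ord0)).
- by move=> _ [j _ <-]; exact: cube_gen2.
- by rewrite (gmorph1 phiM) conjg1.
move=> {}g _ gr [j /= j0 <-]; rewrite phiM conjgM gr phi_gen.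
apply/conjg_fixP/commgP/invol_commute; rewrite ?r2 //.
by have := r_rel ord0 (lift ord0 j); rewrite string_matrix_far // lift0 ltnS j0.
Qed.

(** The involution in P that corresponds to the one of F in W; [psi_gen_vt] shows
that the choice of a group element that moves the base vertex to F is immaterial. *)
Definition psi_gen (F : V) : P := r ord0 ^ phi (vrep F).

Lemma psi_gen_vt g : psi_gen (vt g) = r ord0 ^ phi g.
Proof.
have : vertex_stab tau (vrep (vt g) * g^-1) by apply/vtrans_base_eq; exact: vrepK.
by move/phi_stab; rewrite phiM (gmorphV phiM) conjgM => /(canRL (conjgKV _)).
Qed.

Lemma phi_beta : phi (cube_beta n) = weval r (w_beta n).
Proof.
rewrite weval_beta (big_morph phi phiM (gmorph1 phiM)).
by apply: eq_bigr => j _; rewrite phi_gen.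
Qed.

(** For i = 1 this is a conjugate of the Coxeter relation of order 4, because the
Coxeter element of the cube is the product of its first factor and an element of
the vertex stabilizer. *)
Lemma phi_betaX_rel i : (0 < i < n)%N ->
  (r ord0 * r ord0 ^ phi (cube_beta n ^+ i)) ^+ 2 = 1.
Proof.
move=> lti; have [i1|i1] := leqP 2 i.
  have R : big_relators (wpow (w_rho0 n ++ winv (wpow (w_beta n) i) ++ w_rho0 n ++
      wpow (w_beta n) i) 2) by right; left; exists i => //=; lia.
  have := pres_relator R; rewrite weval_pow weval_twisted_pair -phi_beta.
  by rewrite (gmorphX phiM).
have -> : i = 1%N by lia.
have [b Sb ->] : exists2 b, vertex_stab tau b & cube_beta n = ctau n 0 * b.
  exists (ascent (ctau n) 1 n.-1); last first.
    rewrite -(ascentSl (@ctau2 n)) cube_betaE; congr ascent.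
    by rewrite prednK // ltnW.
  apply: generatedV; apply: (generated_descent n2) => j j0; have ltj : (j < n)%N by lia.
  rewrite -[j]/(val (Ordinal ltj)) ctauE; apply: mem_generated.
  by exists (Ordinal ltj) => //=; lia.
rewrite expg1 phiM conjgM -{1}(phi_stab Sb) -conjMg -conjXg.
have n0 : (0 < n)%N by exact: ltnW.
rewrite -[0%N]/(val (Ordinal n0)) ctauE phi_gen -(invol_mulX2 _ (r2 _)) -expgnA.
have := r_rel ord0 (lift ord0 (Ordinal n0)); rewrite string_matrix_next ?lift0 //= => ->.
by rewrite conj1g.
Qed.

Lemma phi_center_rel : (r ord0 * r ord0 ^ phi alpha) ^+ s = 1.
Proof.
have R : big_relators (wpow (w_rho0 n ++ wpow (w_beta n) n ++ w_rho0 n ++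
    wpow (w_beta n) n) s) by right; right.
have := pres_relator R; rewrite weval_pow !weval_cat !weval_gen weval_pow -phi_beta.
rewrite -(gmorphX phiM) -[cube_beta n ^+ n]/alpha conjgE.
have -> // : (phi alpha)^-1 = phi alpha.
by rewrite -(gmorphV phiM) (involV (cube_center2 n2)).
Qed.

(** The double cosets of the vertex stabilizer move the pair of vertices to the
base vertex and its image under a power of the Coxeter element. *)
Lemma psi_rel (F F' : V) : (psi_gen F * psi_gen F') ^+ diagram_matrix alpha s F F' = 1.
Proof.
rewrite -(vrepK F) -(vrepK F'); move: (vrep F) (vrep F') => g h; rewrite !psi_gen_vt.
have [i [a [b [lein Sa Sb Dhg]]]] := double_coset_beta n2 (h * g^-1).
have Dh : h = a * cube_beta n ^+ i * b * g by rewrite -Dhg mulgVK.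
have Dvh : vt h = vt (cube_beta n ^+ i * (b * g)).
  by rewrite Dh -!mulgA -vtM [vt a](stab_fix Sa) -vt1 vtM mul1g.
have Dvg : vt g = vt (b * g) by rewrite -[RHS]vtM [vt b](stab_fix Sb) -vt1 vtM mul1g.
rewrite -!psi_gen_vt Dvh Dvg !psi_gen_vt [phi (_ ^+ i * _)]phiM conjgM -conjMg -conjXg.
suff -> : (r ord0 * r ord0 ^ phi (cube_beta n ^+ i)) ^+
    diagram_matrix alpha s (vt (b * g)) (vt (cube_beta n ^+ i * (b * g))) = 1 by exact: conj1g.
rewrite -[b * g in X in diagram_matrix _ _ X _]mul1g -[vt (1 * _)]vtM -[vt (_ ^+ i * _)]vtM.
rewrite (diagram_matrix_vtrans cs).
have [i0|i0] := posnP i.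
  rewrite i0 /diagram_matrix eqxx (gmorph1 phiM) conjg1 expg1; exact: r2.
have [ltin|leni] := ltnP i n.
  by rewrite diagram_matrixE (negPf (vcode_base_beta _)) ?phi_betaX_rel //; lia.
have -> : i = n by lia.
have := vcode_center 1; rewrite mul1g diagram_matrixE => ->.
by rewrite eqxx; case: (vcode _).2; exact: phi_center_rel.
Qed.

Definition psi : W -> P := plift (coxeter_weval psi_rel).

Lemma psiM : {morph psi : u v / u * v}. Proof. exact: pliftM. Qed.

Lemma psi_sigma g : psi (sigma (vt g)) = r ord0 ^ phi g.
Proof. by rewrite -psi_gen_vt; exact: plift_gen. Qed.

Lemma psi_dact g w : psi (dact g w) = psi w ^ phi g.
Proof.
apply: (pres_hom_eq (f := fun w => psi (dact g w)) (g := fun w => psi w ^ phi g)).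
- by move=> u v; rewrite (dactJ cs) psiM.
- by move=> u v; rewrite psiM conjMg.
- move=> F; rewrite -[pgen _ F]/(sigma F) -(vrepK F) dact_sigma !psi_sigma.
  by rewrite phiM conjgM.
Qed.

Definition theta (x : T) : P := phi x.1 * psi x.2.

Lemma thetaM : {morph theta : x y / x * y}.
Proof.
move=> [g u] [h v]; rewrite /theta /= phiM psiM psi_dact conjgE -!mulgA.
by rewrite mulVKg.
Qed.

Lemma theta_rho i : theta (rho i) = r i.
Proof.
case: (unliftP ord0 i) => [j ->|->].
  by rewrite rhoS /theta /= (gmorph1 psiM) mulg1 phi_gen.
by rewrite rho0 /theta /= (gmorph1 phiM) mul1g psi_sigma (gmorph1 phiM) conjg1.
Qed.

(** The morphism theta is a left inverse of the canonical morphism, since it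
returns the generators. *)
Lemma twist_presented : presented_by rho big_relators.
Proof.
apply: (presented_by_ker (R1 := twist_relators)) => x x1.
have E := pres_hom_eq (f := fun x => theta (plift twist_relators x)) (g := id).
rewrite -[x]E => [|u v|//|i]; first by rewrite x1; exact: gmorph1 thetaM.
  by rewrite pliftM thetaM.
by rewrite plift_gen theta_rho.
Qed.

End Inverse.

(** * The toroidal residue *)

Section CommutingInvolutions.
Variables (m : nat) (G : groupType) (c : 'I_m -> G).
Hypotheses (c2 : forall v, c v * c v = 1) (c_comm : forall u v, commute (c u) (c v)).

Definition invol_prod (e : {ffun 'I_m -> bool}) : G := \prod_(v < m) c v ^+ e v.

Lemma invol_prodM e v : exists e', invol_prod e * c v = invol_prod e'.
Proof.
exists [ffun u => if u == v then ~~ e u else e u].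
rewrite /invol_prod (prod_mul_at (q := v)) ?index_enum_uniq ?mem_index_enum //.
  apply: eq_bigr => u _; rewrite ffunE; case: eqP => // ->.
  by case: (e v); rewrite /= ?expg1 ?expg0 ?mul1g.
by move=> u _; apply: commuteX.
Qed.

End CommutingInvolutions.

Section TorusNormalForm.
Variables (G : groupType) (x0 x1 x2 : G).
Hypotheses (x0x0 : x0 * x0 = 1) (x1x1 : x1 * x1 = 1) (x2x2 : x2 * x2 = 1).
Hypotheses (x01 : (x0 * x1) ^+ 4 = 1) (x12 : (x1 * x2) ^+ 4 = 1) (x02 : (x0 * x2) ^+ 2 = 1).
Hypothesis torus : (x0 * (x1 * (x2 * x1))) ^+ 4 = 1.

(** The group of a square is generated by x1 and x2; these elements move its base
vertex to its four vertices. *)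
Definition square_word (v : nat) : G := nth 1 [:: 1; x1; x1 * x2; x1 * x2 * x1] v.

Definition square_conj (v : 'I_4) : G := x0 ^ square_word v.

Lemma x0J2 : x0 ^ x2 = x0.
Proof. exact/conjg_fixP/commgP/invol_commute. Qed.

Lemma commute_conj_invol y : y * y = 1 -> (x0 * y) ^+ 4 = 1 -> commute x0 (x0 ^ y).
Proof.
move=> y2; rewrite -[4%N]/(2 * 2)%N expgnA (invol_mulX2 x0 y2) => E.
by apply: invol_commute; rewrite // -conjMg x0x0 conj1g.
Qed.

(** Conjugation by x1 and x2 acts on these four elements as the generators of the
group of a square act on its vertices. *)
Lemma square_conj_step y : y = x1 \/ y = x2 ->
  forall v, exists u, square_conj v ^ y = square_conj u.
Proof.
have braid : x1 * x2 * x1 * x2 = x2 * (x1 * x2 * x1) by rewrite invol_braid4 ?mulgA.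
move=> Dy; suff H v : exists2 k, (k < 4)%N & square_conj v ^ y = x0 ^ square_word k.
  by move=> v; have [k lt4 ->] := H v; exists (Ordinal lt4).
rewrite /square_conj /square_word -conjgM.
case: v => -[|[|[|[|v]]]] //= _; case: Dy => ->.
- by exists 1%N; rewrite // mul1g.
- by exists 0%N; rewrite // mul1g x0J2 conjg1.
- by exists 0%N; rewrite // x1x1.
- by exists 2.
- by exists 3.
- by exists 1%N; rewrite // -mulgA x2x2 mulg1.
- by exists 2; rewrite // -mulgA x1x1 mulg1.
- by exists 3; rewrite // braid conjgM x0J2.
Qed.

Lemma square_conj2 v : square_conj v * square_conj v = 1.
Proof. by rewrite -conjMg x0x0 conj1g. Qed.

(** Adjacent vertices are covered by the relation of order 4 between x0 and x1,
opposite ones by the toroidal relation, and conjugation by x1 and x2 moves all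
pairs of vertices to these two cases. *)
Lemma square_conj_commute u v : commute (square_conj u) (square_conj v).
Proof.
have cJ (a b y : G) : commute a b -> commute (a ^ y) (b ^ y).
  by move=> ab; rewrite /commute -!conjMg ab.
pose c k := x0 ^ square_word k.
have c01 : commute (c 0%N) (c 1%N) by rewrite /c /square_word /= conjg1; exact: commute_conj_invol.
have c03 : commute (c 0%N) (c 3%N).
  rewrite /c /square_word /= conjg1; apply: commute_conj_invol; last by rewrite -!mulgA.
  by rewrite !mulgA -(mulgA (x1 * x2)) x1x1 mulg1 -(mulgA x1) x2x2 mulg1.
have c02 : commute (c 0%N) (c 2%N).
  by have := cJ _ _ x2 c01; rewrite /c /square_word /= conjg1 x0J2 -conjgM.
have c12 : commute (c 1%N) (c 2%N).
  have := cJ _ _ x1 c03; rewrite /c /square_word /= conjg1 -conjgM.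
  by rewrite -(mulgA (x1 * x2)) x1x1 mulg1.
have c13 : commute (c 1%N) (c 3%N) by have := cJ _ _ x1 c02; rewrite /c /square_word /= conjg1 -conjgM.
have c23 : commute (c 2%N) (c 3%N).
  have := cJ _ _ x2 c13; rewrite /c /square_word /= -!conjgM.
  by rewrite (invol_braid4 x1x1 x2x2 x12) -!mulgA (conjgM x0 x2) x0J2.
rewrite /square_conj -/(c u) -/(c v).
by case: u => -[|[|[|[|u]]]] //= _; case: v => -[|[|[|[|v]]]] //= _;
  (exact: commute_refl || assumption || apply: commute_sym).
Qed.

Definition torus_elt (e : {ffun 'I_4 -> bool}) (d : 'I_4 * bool) : G :=
  invol_prod square_conj e * dihedral_elt x1 x2 d.

(** The element x0 moves to the left of the dihedral factor as one of its four
conjugates, which the product of commuting involutions absorbs. *)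
Lemma torus_eltM y e d : y = x0 \/ y = x1 \/ y = x2 ->
  exists e' d', torus_elt e d * y = torus_elt e' d'.
Proof.
case=> [|[|]] ->; rewrite /torus_elt -mulgA; last first.
- by have [d' ->] := dihedral_eltMy x2x2 x12 d; exists e, d'.
- by have [d' ->] := dihedral_eltMx x2 x1x1 d; exists e, d'.
set k := dihedral_elt _ _ _; pose Q z := forall v, exists u, square_conj v ^ z = square_conj u.
have QM z w : Q z -> Q w -> Q (z * w).
  by move=> Qz Qw v; have [u Du] := Qz v; have [u' Du'] := Qw u; exists u'; rewrite conjgM Du.
have Q1 : Q 1 by move=> v; exists v; rewrite conjg1.
have Qx1 : Q x1 by apply: square_conj_step; left.
have Qx2 : Q x2 by apply: square_conj_step; right.
have Qk : Q k^-1.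
  rewrite /k /dihedral_elt invgM; apply: (QM); rewrite -expVgn.
    by rewrite (involV x1x1); case: d.2; rewrite ?expg1 ?expg0.
  rewrite invgM (involV x1x1) (involV x2x2).
  by elim: (nat_of_ord d.1) => // i IHi; rewrite expgS; exact: (QM _ _ (QM _ _ Qx2 Qx1) IHi).
have [u Du] := Qk ord0.
have [e' De'] := invol_prodM square_conj2 square_conj_commute e u.
exists e', d; rewrite -De' -/k -[RHS]mulgA; congr (_ * _).
by rewrite -Du /square_conj conjg1 conjgE invgK (mulgA k x0) (mulgVK k).
Qed.

End TorusNormalForm.

Lemma rho_inord k : (k < n)%N -> rho (inord k.+1) = tinl (ctau n k).
Proof.
move=> ltk; have -> : inord k.+1 = lift ord0 (Ordinal ltk).
  by apply: val_inj; rewrite /= inordK.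
by rewrite rhoS -ctauE.
Qed.

Lemma rho_inord0 : rho (inord 0) = rho ord0.
Proof. by congr rho; apply: val_inj; rewrite /= inordK. Qed.

Lemma gactX (g : CG) k x : gact (g ^+ k) x = iter k (gact g) x.
Proof. by elim: k => [|k IHk]; rewrite ?(gact1 n2) // expgSr (gactM n2) IHk. Qed.

Lemma dihedral_tau_neq1 (d : 'I_4 * bool) : dihedral_elt (ctau n 0) (ctau n 1) d = 1 ->
  d = (ord0, false).
Proof.
have n0 : (0 < n)%N by exact: ltnW.
have act x : gact (dihedral_elt (ctau n 0) (ctau n 1) d) x =
    iter d.2 (spoint_act 0) (iter d.1 (spoint_act 1 \o spoint_act 0) x).
  rewrite /dihedral_elt (gactM n2) !gactX.
  have -> y : iter d.2 (gact (ctau n 0)) y = iter d.2 (spoint_act 0) y.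
    by case: d.2 => //=; rewrite (gact_ctau n2).
  congr (iter _ _ _); elim: (nat_of_ord d.1) => //= i ->.
  by rewrite (gactM n2) !(gact_ctau n2).
move=> E; move: (act (0%N, false)) (act (1%N, false)); rewrite E !(gact1 n2).
by case: d {E act} => -[[|[|[|[|k]]]] lt4] [] //= _ _; congr (_, _); apply: val_inj.
Qed.

Section Torus.
Hypothesis n3 : (3 <= n)%N.

Definition square_elt (v : 'I_4) : CG := square_word (ctau n 0) (ctau n 1) v.

Lemma square_signs v : [/\ signs (square_elt v) 0 = (v == 1%N :> nat) || (v == 3 :> nat),
  signs (square_elt v) 1 = (v == 2 :> nat) || (v == 3 :> nat) &
  signs (square_elt v) 2 = false].
Proof.
have n1 : (1 < n)%N by [].
have sw g p : signs (g * ctau n 1) p = signs g (adj_swap 0 p) by rewrite (signs_swap n2).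
have st p : signs (ctau n 0) p = (p == 0%N) by rewrite -[ctau n 0]mul1g signs_tau0 (signs1 n2).
rewrite /square_elt /square_word.
by case: v => -[|[|[|[|v]]]] //= _; rewrite !(signs_tau0, sw, st, signs1 n2).
Qed.

(** The third coordinate, which exists as n is at least 3, is positive at all four
vertices of the square, so none of them are antipodal. *)
Lemma square_elt_neq u v : u != v ->
  (vcode (vt (square_elt u))).1 != (vcode (vt (square_elt v))).1.
Proof.
have [u0 u1 u2] := square_signs u; have [v0 v1 v2] := square_signs v.
have n0 : (0 < n)%N by lia.
have neq p : (p < 2)%N -> signs (square_elt u) p != signs (square_elt v) p ->
    (vcode (vt (square_elt u))).1 != (vcode (vt (square_elt v))).1.
  move=> p2 uv; apply: (@vcode_neq _ _ p 2); rewrite ?u2 ?v2 ?addbF //; lia.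
move=> uv; have [E0|/neq] := eqVneq (signs (square_elt u) 0) (signs (square_elt v) 0); last exact.
have [E1|/neq] := eqVneq (signs (square_elt u) 1) (signs (square_elt v) 1); last exact.
case/eqP: uv; apply: val_inj; move: E0 E1; rewrite u0 u1 v0 v1.
by case: u v {u0 u1 u2 v0 v1 v2 neq} => -[|[|[|[|u]]]] //= _ [[|[|[|[|v]]]]].
Qed.

Lemma square_elt3 : square_elt (inord 3) = ctau n 0 * ctau n 1 * ctau n 0.
Proof. by rewrite /square_elt /square_word inordK. Qed.

Lemma torus_relators_rho r :
  torus_relators 4 r -> weval (fun i : 'I_3 => rho (inord i)) r = 1.
Proof.
case=> [|->]; first apply: coxeter_weval => i j.
  have := rho_rel (inord i) (inord j).
  have -> // : string_matrix n.+1 [:: 4, 4 & nseq (n - 2) 3] (inord i) (inord j) =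
     string_matrix 3 [:: 4; 4] i j.
  have [i3 j3] : (i < n.+1)%N /\ (j < n.+1)%N by have := ltn_ord i; have := ltn_ord j; lia.
  rewrite /string_matrix -!val_eqE /= !inordK //.
  by case: i j {i3 j3} => -[|[|[|i]]] //= _ [[|[|[|j]]]].
rewrite weval_pow !weval_cat !weval_gen !inordK // rho_inord0 !rho_inord ?(ltnW n2) //.
rewrite -!tinlM; set y := ctau n 0 * _.
have Dy : y = square_elt (inord 3) by rewrite square_elt3 -mulgA.
have y2 : y * y = 1.
  by rewrite /y !mulgA (mulgtt (@ctau2 n)) (mulgtt (@ctau2 n)) ctau2.
have ty2 : tinl y * tinl y = 1 by rewrite -tinlM y2.
rewrite -[4%N]/(2 * 2)%N expgnA (invol_mulX2 (rho ord0) ty2) rho0_conj.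
rewrite -(gmorphX tinrM) sigma_commute; first exact: gmorph1 tinrM.
rewrite Dy (_ : 1 = square_elt ord0) //; apply: square_elt_neq.
by rewrite -val_eqE /= inordK.
Qed.

(** An element of the kernel has a trivial dihedral factor, as the cube group
contains the dihedral group of order 8; the coordinates of its other factor in
W, taken at the pairs of the vertices of the square, are trivial. *)
Lemma torus_presented : presented_by (fun i : 'I_3 => rho (inord i)) (torus_relators 4).
Proof.
apply: (presented_by_ker (R1 := torus_relators_rho)); set f := plift _.
have fM : {morph f : x y / x * y} by exact: pliftM.
pose x k := pgen (torus_relators 4) (inord k).
have rel i j : (x i * x j) ^+ string_matrix 3 [:: 4; 4] (inord i) (inord j) = 1.
  by apply: coxeter_rel; left.
have xx i : x i * x i = 1 by have := rel i i; rewrite string_matrix_diag.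
have x01 : (x 0%N * x 1%N) ^+ 4 = 1 by have := rel 0%N 1%N; rewrite string_matrix_next !inordK.
have x12 : (x 1%N * x 2) ^+ 4 = 1 by have := rel 1%N 2; rewrite string_matrix_next !inordK.
have x02 : (x 0%N * x 2) ^+ 2 = 1 by have := rel 0%N 2; rewrite string_matrix_far ?inordK.
have torus : (x 0%N * (x 1%N * (x 2 * x 1%N))) ^+ 4 = 1.
  have R : torus_relators 4 (wpow (wgen (inord 0) ++ wgen (inord 1) ++ wgen (inord 2) ++
    wgen (inord 1)) 4) by right.
  by have := pres_relator R; rewrite weval_pow !weval_cat !weval_gen.
have nf w : exists e d, w = torus_elt (x 0%N) (x 1%N) (x 2) e d.
  have gen2 i : pgen (torus_relators 4) i * pgen (torus_relators 4) i = 1.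
    by have := xx i; rewrite /x inord_val.
  apply: (invol_pres_ind (P := fun w => exists e d, w = torus_elt (x 0%N) (x 1%N) (x 2) e d) gen2).
    exists [ffun=> false], (ord0, false); rewrite /torus_elt /dihedral_elt /= !mulg1 /invol_prod.
    by rewrite big1 // => v _; rewrite ffunE.
  move=> _ i [e [d ->]].
  have Dy : pgen (torus_relators 4) i = x 0%N \/ pgen _ i = x 1%N \/ pgen _ i = x 2.
    by rewrite -(inord_val i); case: i => -[|[|[|i]]] //= _; [left|right; left|right; right].
  have [e' [d' ->]] := torus_eltM (xx 0%N) (xx 1%N) (xx 2) x01 x12 x02 torus e d Dy.
  by exists e', d'.
have f0 : f (x 0%N) = tinr (sigma (vt 1)) by rewrite /f /x plift_gen inordK // rho_inord0 rho0.
have f1 : f (x 1%N) = tinl (ctau n 0) by rewrite /f /x plift_gen inordK // rho_inord // ltnW.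
have f2 : f (x 2) = tinl (ctau n 1) by rewrite /f /x plift_gen inordK // rho_inord.
have fc v : f (square_conj (x 0%N) (x 1%N) (x 2) v) = tinr (sigma (vt (square_elt v))).
  rewrite (gmorphJ fM) f0 -[square_elt v]mul1g -tinr_sigmaJ; congr (_ ^ _).
  rewrite /square_elt /square_word; case: v => -[|[|[|[|v]]]] //= _;
    by rewrite ?fM ?(gmorph1 fM) ?tinlM ?f1 ?f2.
move=> w; have [e [d ->]] := nf w; rewrite /torus_elt fM (dihedral_elt_morph _ _ _ fM) f1 f2.
rewrite -(dihedral_elt_morph _ _ _ tinlM).
have -> : f (invol_prod (square_conj (x 0%N) (x 1%N) (x 2)) e) =
    tinr (\prod_(v < 4) sigma (vt (square_elt v)) ^+ e v).
  rewrite (big_morph f fM (gmorph1 fM)) (big_morph tinr tinrM (gmorph1 tinrM)).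
  by apply: eq_bigr => v _; rewrite (gmorphX fM) fc (gmorphX tinrM).
move=> E; have := congr1 fst E; rewrite /= mul1g => /dihedral_tau_neq1 Dd.
have D1 (K : groupType) (a b : K) : dihedral_elt a b (@ord0 3, false) = 1.
  by rewrite /dihedral_elt /= mulg1.
move: E; rewrite Dd !D1 (gmorph1 tinlM) !mulg1 => /(congr1 snd) /= E.
rewrite /invol_prod big1 // => v _; case ev: (e v) => //.
have [h [hM hv hu]] := sigma_separated (square_elt v); case/eqP: hv.
have := congr1 h E; rewrite (gmorph1 hM) (big_morph h hM (gmorph1 hM)).
rewrite (eq_bigr (fun u => if u == v then h (sigma (vt (square_elt v))) else 1)) => [|u _].
  by rewrite -big_mkcond big_pred1_eq.
rewrite (gmorphX hM); case: eqP => [->|/eqP uv]; first by rewrite ev.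
by rewrite hu ?expg1n //; exact: square_elt_neq.
Qed.

End Torus.
End TwistedCube.

Theorem corollary3p8 (n s : nat) (hn : (3 <= n)%N) (hs : (2 <= s)%N) :
  exists cs : centrally_symmetric_polytope (cube_gen n) (cube_center n),
  let G : groupType := twist_group cs s in
  let rho : 'I_n.+1 -> G := twist_gen cs s in
  let Dsq := {ffun 'I_(2 ^ n.-1)%N -> 'D_(2 * s)%N} in
  [/\ string_C_group rho,
      schlafli_type rho [:: 4, 4 & nseq (n - 2) 3],
      (exists f : {multiplicative diagram_group (cube_gen n) (cube_center n) s -> Dsq},
         bijective f) /\
      (exists (a : autaction (cube_group n) Dsq)
              (f : {multiplicative G -> sdprod_of a}), bijective f),
      ([set: G] #= `I_((2 * s) ^ (2 ^ n.-1) * 2 ^ n * n`!)%N)%card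
    & presented_by rho
        (coxeter_relators (string_matrix n.+1 [:: 4, 4 & nseq (n - 2) 3]) `|`
         extra_relators n s) /\
      presented_by (fun i : 'I_3 => rho (inord i)) (torus_relators 4)].
Proof.
have n2 : (2 <= n)%N by exact: ltnW.
exists (cube_centrally_symmetric n2); split.
- exact: twist_string_C_group.
- exact: twist_schlafli.
- by split; [exact: diagram_group_dihedral|exact: twist_semidirect].
- exact: twist_card.
- by split; [exact: twist_presented|exact: torus_presented].
Qed.
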